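(* Consider the plant $\dot{\mathbf x}=\mathbf f(\mathbf x)+\boldsymbol\vartheta(\mathbf x,\boldsymbol\theta)+\mathbf g(\mathbf x)u$, partitioned as $$\dot{\mathbf x}_1=\mathbf f_1(\mathbf x)+\mathbf g_1(\mathbf x)u,\quad \dot{\mathbf x}_2'=\mathbf f_2'(\mathbf x)+\boldsymbol\nu'(\mathbf x,\boldsymbol\theta)+\mathbf g_2'(\mathbf x)u,\quad \dot{\mathbf x}_2''=\mathbf f_2''(\mathbf x)+\boldsymbol\nu''(\mathbf x,\boldsymbol\theta)+\mathbf g_2''(\mathbf x)u,$$ with $\mathbf x=\mathbf x_1\oplus\mathbf x_2$, $\mathbf x_2=\mathbf x_2'\oplus\mathbf x_2''$, $\dim\mathbf x_1=m$, $\dim\mathbf x_2'=m_1$, $\dim\mathbf x_2''=n-m-m_1$, $0\le m_1\le n-m$. Let $\psi(\mathbf x,t)$ be given, $z(\mathbf x,\boldsymbol\theta,t)=L_{\boldsymbol\nu(\mathbf x,\boldsymbol\theta)}\psi(\mathbf x,t)$, and assume: (A1) for every $\delta>0$ there is $\varepsilon(\delta)\ge0$ such that $|\psi(\mathbf x,t)|\le\delta\Rightarrow\|\mathbf x\|\le\varepsilon(\delta)$ along solutions of the plant; (A2) $|L_{\mathbf g}\psi(\mathbf x,t)|>\delta_1>0$ for all $\mathbf x\in R^n$, $t>0$; (A3) for every $\boldsymbol\theta\in\Omega_\theta$ there is $\hat{\boldsymbol\theta}^*\in\Omega_{\hat\theta}\subset R^d$ such that for all $\mathbf x,t$, with $u^*=(L_{\mathbf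 g}\psi)^{-1}(-\varphi(\psi)-L_{\mathbf f}\psi-L_{\boldsymbol\nu(\mathbf x,\hat{\boldsymbol\theta}^* )}\psi-\partial\psi/\partial t)$, one has $\frac{\partial\psi}{\partial\mathbf x}[\mathbf f(\mathbf x)+\boldsymbol\vartheta(\mathbf x,\boldsymbol\theta)+\mathbf g(\mathbf x)u^*]+\frac{\partial\psi}{\partial t}+\varphi(\psi)=0$ (so $z(\mathbf x,\hat{\boldsymbol\theta}^*,t)=z(\mathbf x,\boldsymbol\theta,t)$); (A4) $\varphi\in C^0$, $\varphi(\psi)\psi>0$ for $\psi\ne0$, $\int_0^\psi\varphi(\varsigma)d\varsigma\to\infty$ as $|\psi|\to\infty$; (A5) $\boldsymbol\alpha:R^n\times R\to R^d$ satisfies $(z(\mathbf x,\hat{\boldsymbol\theta},t)-z(\mathbf x,\hat{\boldsymbol\theta}^*,t))(\boldsymbol\alpha(\mathbf x,t)^T(\hat{\boldsymbol\theta}-\hat{\boldsymbol\theta}^* ))>0$ whenever $z(\mathbf x,\hat{\boldsymbol\theta},t)\ne z(\mathbf x,\hat{\boldsymbol\theta}^*,t)$, and $|z(\mathbf x,\hat{\boldsymbol\theta},t)-z(\mathbf x,\hat{\boldsymbol\theta}^*,t)|\le D|\boldsymbol\alpha(\mathbf x,t)^T(\hat{\boldsymbol\theta}-\hat{\boldsymbol\theta}^* )|$ with $D>0$; (A6) there is $D_1>0$ with $|z(\mathbf x,\hat{\boldsymbol\theta},t)-z(\mathbf x,\hat{\boldsymbol\theta}^*,t)|\ge D_1|\boldsymbol\alpha(\mathbf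 x,t)^T(\hat{\boldsymbol\theta}-\hat{\boldsymbol\theta}^* )|$ for all $\mathbf x,\hat{\boldsymbol\theta},\hat{\boldsymbol\theta}^*$, $t>0$; (A7) there exist a partition $\mathbf x=\mathbf x_1\oplus\mathbf x_2'\oplus\mathbf x_2''$ with $\dim\mathbf x_1=m$, $\dim\mathbf x_2'=m_1$, $\dim\mathbf x_2''=n-m-m_1$, $0\le m_1\le n-m$, whose components satisfy $\dot{\mathbf x}_1=\mathbf f_1(\mathbf x)+\mathbf g_1(\mathbf x)u$, $\dot{\mathbf x}_2'=\mathbf f_2'(\mathbf x)+\boldsymbol\nu'(\mathbf x,\boldsymbol\theta)+\mathbf g_2'(\mathbf x)u$, $\dot{\mathbf x}_2''=\mathbf f_2''(\mathbf x)+\boldsymbol\nu''(\mathbf x,\boldsymbol\theta)+\mathbf g_2''(\mathbf x)u$, a system $\dot{\boldsymbol\xi}=\mathbf f_\xi(\mathbf x,\boldsymbol\xi,t)$, $\mathbf y_\xi=\mathbf h_\xi(\boldsymbol\xi)$, $\boldsymbol\xi\in R^r$, with $\mathbf f_\xi:R^n\times R^r\times R_+\to R^r$, $\mathbf h_\xi:R^r\to R^{n-m-m_1}$ of class $C^1$, and a function $\Psi(\tilde{\mathbf x},t)\in C^1$, $\tilde{\mathbf x}=\mathbf x_1\oplus\mathbf x_2'\oplus\mathbf h_\xi$, such that $$\frac{\partial\Psi(\tilde{\mathbf x},t)}{\partial\mathbf x_2'}=\psi(\tilde{\mathbf x},t)\frac{\partial\boldsymbol\alpha(\tilde{\mathbf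 x},t)}{\partial\mathbf x_2'},\qquad \mathbf x\in L_\infty\Rightarrow\boldsymbol\xi\in L_\infty,$$ for any $\boldsymbol\theta\in\Omega_\theta$, $t\in R_+$ along the solutions of the plant. Then for the extended system $\dot{\mathbf x}=\mathbf f(\mathbf x)+\boldsymbol\vartheta(\mathbf x,\boldsymbol\theta)+\mathbf g(\mathbf x)u$, $\dot{\boldsymbol\xi}=\mathbf f_\xi(\mathbf x,\boldsymbol\xi,t)$, $\mathbf y_\xi=\mathbf h_\xi(\boldsymbol\xi)$, there exist a control function $$u(\mathbf x,\mathbf h_\xi,\hat{\boldsymbol\theta},t)=(L_{\mathbf g(\mathbf x)}\psi(\mathbf x,t))^{-1}\left(-\varphi(\psi)-L_{\mathbf f}\psi(\mathbf x,t)-L_{\boldsymbol\vartheta(\tilde{\mathbf x},\hat{\boldsymbol\theta})}\psi(\tilde{\mathbf x},t)-\frac{\partial\psi(\mathbf x,t)}{\partial t}\right)$$ and adaptation algorithms $\hat{\boldsymbol\theta}=\Gamma(\hat{\boldsymbol\theta}_P(\mathbf x,\tilde{\mathbf x},t)+\hat{\boldsymbol\theta}_I(t))$, $\Gamma>0$ (the explicit ones written in the context), such that: P8) if $|\varphi(\psi)|\ge K|\psi|$, $K>0$, and if along the solutions of the plant and the $\boldsymbol\xi$-system $$z(\mathbf x,\boldsymbol\theta,t)-z(\tilde{\mathbf x},\boldsymbol\theta,t)\in L_\infty,\qquad (\psi(\mathbf x,t)-\psi(\tilde{\mathbf x},t))\frac{\partial\boldsymbol\alpha(\tilde{\mathbf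 x},t)}{\partial\mathbf x_2'}\boldsymbol\nu'(\mathbf x,\boldsymbol\theta)\in L_\infty,$$ then $\psi(\mathbf x,t),\mathbf x,\boldsymbol\xi,\hat{\boldsymbol\theta}\in L_\infty$; P9) if $\partial\boldsymbol\alpha(\tilde{\mathbf x},t)/\partial\mathbf x_2'\equiv0$ or $\psi(\mathbf x,t)=\psi(\tilde{\mathbf x},t)$, and furthermore $z(\mathbf x,\boldsymbol\theta,t)-z(\tilde{\mathbf x},\boldsymbol\theta,t)\in L_2$ for any $\boldsymbol\theta\in\Omega_\theta$, $t>0$ along the solutions of the plant and the $\boldsymbol\xi$-system, then $\psi(\mathbf x,t)\in L_2\cap L_\infty$, $\dot\psi\in L_2$, $z(\tilde{\mathbf x},\boldsymbol\theta,t)-z(\tilde{\mathbf x},\hat{\boldsymbol\theta},t)\in L_2$, $\mathbf x,\boldsymbol\xi\in L_\infty$; if in addition $\partial\psi(\mathbf x,t)/\partial\mathbf x$ and $\partial\psi(\mathbf x,t)/\partial t$ are uniformly bounded in $t$ and $z(\mathbf x,\boldsymbol\theta,t)-z(\tilde{\mathbf x},\boldsymbol\theta,t)\in L_\infty$, then $\dot\psi\in L_\infty$, $z(\tilde{\mathbf x},\boldsymbol\theta,t)-z(\tilde{\mathbf x},\hat{\boldsymbol\theta},t)\in L_\infty$, and $\lim_{t\to\infty}\psi(\mathbf x(t),t)=0$.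
   Context: $\oplus$ denotes concatenation of vectors. $\mathbf f=\mathbf f_1\oplus\mathbf f_2'\oplus\mathbf f_2''$, $\mathbf g=\mathbf g_1\oplus\mathbf g_2'\oplus\mathbf g_2''$, $\boldsymbol\nu=\boldsymbol\nu'\oplus\boldsymbol\nu''$ are $C^1$; $\boldsymbol\vartheta(\mathbf x,\boldsymbol\theta)=(0,\dots,0)^T\oplus\boldsymbol\nu(\mathbf x,\boldsymbol\theta)$ with $m$ zeros; $\boldsymbol\theta\in\Omega_\theta\subset R^d$ is a constant vector of unknown parameters, $u\in R$ the input, $\psi:R^n\times R\to R$ is $C^1$, $\dot\psi$ its time derivative along the solution. $L_{\mathbf f}\psi=\frac{\partial\psi}{\partial\mathbf x}\mathbf f$, $L_{\mathbf g}\psi=\frac{\partial\psi}{\partial\mathbf x}\mathbf g$, $L_{\boldsymbol\nu}\psi=\frac{\partial\psi}{\partial\mathbf x_2}\boldsymbol\nu=L_{\boldsymbol\vartheta}\psi$. $L_{\boldsymbol\vartheta(\tilde{\mathbf x},\hat{\boldsymbol\theta})}\psi(\tilde{\mathbf x},t)=z(\tilde{\mathbf x},\hat{\boldsymbol\theta},t)$ is $z(\cdot,\hat{\boldsymbol\theta},t)$ evaluated at $\tilde{\mathbf x}$ (i.e. $\mathbf x$ with $\mathbf x_2''$ replaced by $\mathbf h_\xi(\boldsymbol\xi)$). Standing conventions: $\boldsymbol\alpha(\mathbf x,t)$ and the control are bounded in $t$; $\boldsymbol\alpha,\psi$ are differentiable as often as needed. $R_+=[0,\infty)$; a signal on $R_+$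 is in $L_2$ iff the integral of its square norm over $[0,\infty)$ is finite and in $L_\infty$ iff it is bounded on $[0,\infty)$; signals are considered along solutions, understood to be defined for all $t\ge0$. $\Gamma>0$ is a symmetric positive definite $d\times d$ gain. Explicit algorithms. Put $\tilde{\mathbf f}=\mathbf f_1(\mathbf x)\oplus\mathbf f_2'(\mathbf x)\oplus\frac{\partial\mathbf h_\xi}{\partial\boldsymbol\xi}\mathbf f_\xi(\mathbf x,\boldsymbol\xi,t)$, $\tilde{\mathbf g}=\mathbf g_1(\mathbf x)\oplus\mathbf g_2'(\mathbf x)\oplus\mathbf 0$ (with $\dim\mathbf x_2''$ zeros), and $L_{\tilde{\mathbf f}}\boldsymbol\alpha(\tilde{\mathbf x},t)=\frac{\partial\boldsymbol\alpha(\tilde{\mathbf x},t)}{\partial\tilde{\mathbf x}}\tilde{\mathbf f}$, etc. For P8 ($\lambda>0$): $$\hat{\boldsymbol\theta}=\Gamma(\hat{\boldsymbol\theta}_P+\hat{\boldsymbol\theta}_I),\quad\hat{\boldsymbol\theta}_P=\psi(\mathbf x,t)\boldsymbol\alpha(\tilde{\mathbf x},t)-\Psi(\tilde{\mathbf x},t),$$ $$\dot{\hat{\boldsymbol\theta}}_I=\varphi(\psi(\mathbf x,t))\boldsymbol\alpha(\tilde{\mathbf x},t)+\frac{\partial\Psi(\tilde{\mathbf x},t)}{\partial t}-\psi(\mathbf x,t)\frac{\partial\boldsymbol\alpha(\tilde{\mathbf x},t)}{\partial t}-\left(\psi(\mathbf x,t)L_{\tilde{\mathbf f}}\boldsymbol\alpha(\tilde{\mathbf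 x},t)-L_{\tilde{\mathbf f}}\Psi(\tilde{\mathbf x},t)\right)-\left(\psi(\mathbf x,t)L_{\tilde{\mathbf g}}\boldsymbol\alpha(\tilde{\mathbf x},t)-L_{\tilde{\mathbf g}}\Psi(\tilde{\mathbf x},t)\right)u(\mathbf x,\mathbf h_\xi,\hat{\boldsymbol\theta},t)-\lambda\hat{\boldsymbol\theta}.$$ For P9: the same formulas with $\lambda=0$ when $\psi(\mathbf x,t)=\psi(\tilde{\mathbf x},t)$, and with $\lambda=0$, $\Psi\equiv0$ when $\partial\boldsymbol\alpha(\tilde{\mathbf x},t)/\partial\mathbf x_2'\equiv0$.
   Formalization: In P9, ψ∈L_2 is claimed only when |φ(ψ)|≥K|ψ| for some K>0 (false otherwise, e.g. ẋ=-x³ with ψ=x); without that condition φ(ψ)∈L_2 is concluded instead. *)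

(* Defs.v *)
(* Library world: MathComp / MathComp-Analysis. *)
From HB Require Import structures.
From mathcomp Require Import all_boot all_order all_algebra.
From mathcomp Require Import all_classical all_reals all_analysis.

Set Implicit Arguments.
Unset Strict Implicit.
Unset Printing Implicit Defensive.

Import Order.TTheory GRing.Theory Num.Theory.
Import numFieldNormedType.Exports.

Local Open Scope classical_set_scope.
Local Open Scope ring_scope.

(* On finite-dimensional spaces, continuity of [p |-> 'd F p v] for every [v]
   is continuity of the derivative in operator norm. *)
Definition C1 (R : realType) (U V : normedModType R) (F : U -> V) : Prop :=
  (forall p, differentiable F p) /\ (forall v, continuous (fun p => 'd F p v)).

Definition C1_on (R : realType) (U V : normedModType R) (D : set U)
    (F : U -> V) : Prop :=
  exists G : U -> V, C1 G /\ (forall p, D p -> G p = F p).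

(* dF/dx (x, t) applied to v; this is also the Lie derivative at x of F along
   any vector field whose value at x is v. *)
Definition Dx (R : realType) (U V : normedModType R) (F : U -> R -> V)
    (x : U) (t : R) (v : U) : V := 'd (F ^~ t) x v.

Definition Dt (R : realType) (U V : normedModType R) (F : U -> R -> V)
    (x : U) (t : R) : V := derive1 (F x) t.

Definition gradx (R : realType) (n : nat) (F : 'cV[R]_n -> R -> R)
    (x : 'cV[R]_n) (t : R) : 'rV[R]_n :=
  \row_i Dx F x t (delta_mx i 0).

(* The state is x = x1 (+) (x2' (+) x2'') in 'cV_(m + (m1 + m2)), where m2
   stands for n - m - m1. The following are the components x1 and x2', also
   used for the corresponding blocks of vector fields. *)
Definition blk1 (R : realType) (m m1 m2 : nat)
    (x : 'cV[R]_(m + (m1 + m2))) : 'cV[R]_m := usubmx x.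

Definition blk2' (R : realType) (m m1 m2 : nat)
    (x : 'cV[R]_(m + (m1 + m2))) : 'cV[R]_m1 := usubmx (dsubmx x).

(* Tangent vector with x2'-component v and other components zero: [Dx F x t]
   at such a vector is (dF/dx2') v. *)
Definition dir2' (R : realType) (m m1 m2 : nat) (v : 'cV[R]_m1) :
    'cV[R]_(m + (m1 + m2)) := col_mx 0 (col_mx v 0).

(* x with its component x2'' replaced by y. *)
Definition tilde (R : realType) (m m1 m2 : nat) (x : 'cV[R]_(m + (m1 + m2)))
    (y : 'cV[R]_m2) : 'cV[R]_(m + (m1 + m2)) :=
  col_mx (blk1 x) (col_mx (blk2' x) y).

Definition vartheta (R : realType) (m m1 m2 d : nat)
    (nu : 'cV[R]_(m + (m1 + m2)) -> 'cV[R]_d -> 'cV[R]_(m1 + m2))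
    (x : 'cV[R]_(m + (m1 + m2))) (theta : 'cV[R]_d) :
    'cV[R]_(m + (m1 + m2)) := col_mx 0 (nu x theta).

(* z(x, theta, t) = (dpsi/dx2) nu(x, theta) *)
Definition zfun (R : realType) (m m1 m2 d : nat)
    (nu : 'cV[R]_(m + (m1 + m2)) -> 'cV[R]_d -> 'cV[R]_(m1 + m2))
    (psi : 'cV[R]_(m + (m1 + m2)) -> R -> R)
    (x : 'cV[R]_(m + (m1 + m2))) (theta : 'cV[R]_d) (t : R) : R :=
  Dx psi x t (vartheta nu x theta).

Definition plant_rhs (R : realType) (m m1 m2 d : nat)
    (f g : 'cV[R]_(m + (m1 + m2)) -> 'cV[R]_(m + (m1 + m2)))
    (nu : 'cV[R]_(m + (m1 + m2)) -> 'cV[R]_d -> 'cV[R]_(m1 + m2))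
    (theta : 'cV[R]_d) (x : 'cV[R]_(m + (m1 + m2))) (u : R) :
    'cV[R]_(m + (m1 + m2)) :=
  f x + vartheta nu x theta + u *: g x.

(* A solution of x' = rhs(x, t) on [0, +oo[: continuous on [0, +oo[ and
   satisfying the equation for t > 0; values at t < 0 are irrelevant. *)
Definition solution (R : realType) (V : normedModType R) (x : R -> V)
    (rhs : R -> V) : Prop :=
  {within `[0, +oo[, continuous x} /\
  (forall t : R, 0 < t -> is_derive t 1 x (rhs t)).

Definition plant_sol (R : realType) (m m1 m2 d : nat)
    (f g : 'cV[R]_(m + (m1 + m2)) -> 'cV[R]_(m + (m1 + m2)))
    (nu : 'cV[R]_(m + (m1 + m2)) -> 'cV[R]_d -> 'cV[R]_(m1 + m2))
    (theta : 'cV[R]_d) (u : R -> R) (x : R -> 'cV[R]_(m + (m1 + m2))) : Prop :=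
  solution x (fun t => plant_rhs f g nu theta (x t) (u t)).

Definition xi_sol (R : realType) (n r : nat)
    (fxi : 'cV[R]_n -> 'cV[R]_r -> R -> 'cV[R]_r)
    (x : R -> 'cV[R]_n) (xi : R -> 'cV[R]_r) : Prop :=
  solution xi (fun t => fxi (x t) (xi t) t).

Definition Linf (R : realType) (V : normedModType R) (s : R -> V) : Prop :=
  [bounded s t | t in `[0, +oo[].

Definition L2 (R : realType) (V : normedModType R) (s : R -> V) : Prop :=
  (@lebesgue_measure R).-integrable `[0, +oo[ (fun t => (`|s t| ^+ 2)%:E).

(* Boundedness in t >= 0, uniform for x in bounded sets. *)
Definition bounded_in_t (R : realType) (U V : normedModType R)
    (F : U -> R -> V) : Prop :=
  forall rho : R, exists M : R,
    forall x t, `|x| <= rho -> 0 <= t -> `|F x t| <= M.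

(* The oriented integral of phi from 0 to s. *)
Definition prim0 (R : realType) (phi : R -> R) (s : R) : R :=
  if 0 <= s then \int[lebesgue_measure]_(v in `[0, s]) phi v
  else - \int[lebesgue_measure]_(v in `[s, 0]) phi v.

(* Needed to pass from phi(psi) in L2 to psi in L2: for phi s = s ^+ 3 the
   solutions psi ~ (1 + 2 t)^(-1/2) of psi' = - phi psi are not in L2. *)
Definition sector (R : realType) (phi : R -> R) : Prop :=
  exists K : R, 0 < K /\ forall s, K * `|s| <= `|phi s|.

Definition dotv (R : realType) (d : nat) (a b : 'cV[R]_d) : R :=
  (a^T *m b) 0 0.

Definition sym_posdef (R : realType) (d : nat) (G : 'M[R]_d) : Prop :=
  G^T = G /\ forall v : 'cV[R]_d, v != 0 -> 0 < dotv v (G *m v).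

(* Only the term z = L_vartheta psi is evaluated at (xt, th), all others at x:
   xt = x gives the nominal control u*, xt = tilde x (h_xi xi) the adaptive
   control. *)
Definition control_at (R : realType) (m m1 m2 d : nat)
    (f g : 'cV[R]_(m + (m1 + m2)) -> 'cV[R]_(m + (m1 + m2)))
    (nu : 'cV[R]_(m + (m1 + m2)) -> 'cV[R]_d -> 'cV[R]_(m1 + m2))
    (psi : 'cV[R]_(m + (m1 + m2)) -> R -> R) (phi : R -> R)
    (x xt : 'cV[R]_(m + (m1 + m2))) (th : 'cV[R]_d) (t : R) : R :=
  (Dx psi x t (g x))^-1 *
  (- phi (psi x t) - Dx psi x t (f x) - zfun nu psi xt th t - Dt psi x t).

Definition control (R : realType) (m m1 m2 d : nat)
    (f g : 'cV[R]_(m + (m1 + m2)) -> 'cV[R]_(m + (m1 + m2)))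
    (nu : 'cV[R]_(m + (m1 + m2)) -> 'cV[R]_d -> 'cV[R]_(m1 + m2))
    (psi : 'cV[R]_(m + (m1 + m2)) -> R -> R) (phi : R -> R)
    (x : 'cV[R]_(m + (m1 + m2))) (y : 'cV[R]_m2) (th : 'cV[R]_d) (t : R) : R :=
  control_at f g nu psi phi x (tilde x y) th t.

Definition ftilde (R : realType) (m m1 m2 r : nat)
    (f : 'cV[R]_(m + (m1 + m2)) -> 'cV[R]_(m + (m1 + m2)))
    (fxi : 'cV[R]_(m + (m1 + m2)) -> 'cV[R]_r -> R -> 'cV[R]_r)
    (hxi : 'cV[R]_r -> 'cV[R]_m2)
    (x : 'cV[R]_(m + (m1 + m2))) (xi : 'cV[R]_r) (t : R) :
    'cV[R]_(m + (m1 + m2)) :=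
  col_mx (blk1 (f x)) (col_mx (blk2' (f x)) ('d hxi xi (fxi x xi t))).

Definition gtilde (R : realType) (m m1 m2 : nat)
    (g : 'cV[R]_(m + (m1 + m2)) -> 'cV[R]_(m + (m1 + m2)))
    (x : 'cV[R]_(m + (m1 + m2))) : 'cV[R]_(m + (m1 + m2)) :=
  col_mx (blk1 (g x)) (col_mx (blk2' (g x)) 0).

Definition thetaP (R : realType) (n d : nat) (psi : 'cV[R]_n -> R -> R)
    (alpha Psi : 'cV[R]_n -> R -> 'cV[R]_d) (x xt : 'cV[R]_n) (t : R) :
    'cV[R]_d :=
  psi x t *: alpha xt t - Psi xt t.

Definition theta_hat (R : realType) (m m1 m2 d r : nat)
    (psi : 'cV[R]_(m + (m1 + m2)) -> R -> R)
    (alpha Psi : 'cV[R]_(m + (m1 + m2)) -> R -> 'cV[R]_d)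
    (hxi : 'cV[R]_r -> 'cV[R]_m2) (Gam : 'M[R]_d)
    (x : 'cV[R]_(m + (m1 + m2))) (xi : 'cV[R]_r) (thI : 'cV[R]_d) (t : R) :
    'cV[R]_d :=
  Gam *m (thetaP psi alpha Psi x (tilde x (hxi xi)) t + thI).

Definition thetaI_rhs (R : realType) (m m1 m2 d r : nat)
    (f g : 'cV[R]_(m + (m1 + m2)) -> 'cV[R]_(m + (m1 + m2)))
    (nu : 'cV[R]_(m + (m1 + m2)) -> 'cV[R]_d -> 'cV[R]_(m1 + m2))
    (psi : 'cV[R]_(m + (m1 + m2)) -> R -> R) (phi : R -> R)
    (alpha Psi : 'cV[R]_(m + (m1 + m2)) -> R -> 'cV[R]_d)
    (fxi : 'cV[R]_(m + (m1 + m2)) -> 'cV[R]_r -> R -> 'cV[R]_r)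
    (hxi : 'cV[R]_r -> 'cV[R]_m2) (lam : R)
    (x : 'cV[R]_(m + (m1 + m2))) (xi : 'cV[R]_r) (th : 'cV[R]_d) (t : R) :
    'cV[R]_d :=
  let xt := tilde x (hxi xi) in
  let ft := ftilde f fxi hxi x xi t in
  let gt := gtilde g x in
  phi (psi x t) *: alpha xt t + Dt Psi xt t - psi x t *: Dt alpha xt t
  - (psi x t *: Dx alpha xt t ft - Dx Psi xt t ft)
  - control f g nu psi phi x (hxi xi) th t
      *: (psi x t *: Dx alpha xt t gt - Dx Psi xt t gt)
  - lam *: th.

(* Solutions (x, xi, thI) of the plant with unknown parameter theta, the
   xi-system, the control and the adaptation algorithm with given lam, Psi. *)
Definition closed_loop (R : realType) (m m1 m2 d r : nat)
    (f g : 'cV[R]_(m + (m1 + m2)) -> 'cV[R]_(m + (m1 + m2)))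
    (nu : 'cV[R]_(m + (m1 + m2)) -> 'cV[R]_d -> 'cV[R]_(m1 + m2))
    (psi : 'cV[R]_(m + (m1 + m2)) -> R -> R) (phi : R -> R)
    (alpha Psi : 'cV[R]_(m + (m1 + m2)) -> R -> 'cV[R]_d)
    (fxi : 'cV[R]_(m + (m1 + m2)) -> 'cV[R]_r -> R -> 'cV[R]_r)
    (hxi : 'cV[R]_r -> 'cV[R]_m2) (Gam : 'M[R]_d) (lam : R)
    (theta : 'cV[R]_d)
    (x : R -> 'cV[R]_(m + (m1 + m2))) (xi : R -> 'cV[R]_r)
    (thI : R -> 'cV[R]_d) : Prop :=
  let th t := theta_hat psi alpha Psi hxi Gam (x t) (xi t) (thI t) t in
  [/\ plant_sol f g nu theta
        (fun t => control f g nu psi phi (x t) (hxi (xi t)) (th t) t) x,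
      xi_sol fxi x xi &
      solution thI (fun t =>
        thetaI_rhs f g nu psi phi alpha Psi fxi hxi lam (x t) (xi t) (th t) t)].

(* Main.v *)
Require Import Defs.
From HB Require Import structures.
From mathcomp Require Import all_boot all_order all_algebra.
From mathcomp Require Import all_classical all_reals all_analysis.
From mathcomp Require Import measurable_realfun ring lra.
Import Order.TTheory GRing.Theory Num.Theory.
Import numFieldNormedType.Exports.
Local Open Scope classical_set_scope.
Local Open Scope ring_scope.

(** The proof is a Lyapunov argument.  The control cancels every term of the
    derivative of psi along the plant except the mismatch of z, so that
    psi' = - phi(psi) + zd - e, where zd = z(x,theta) - z(xt,theta) is the
    error caused by replacing x with xt = tilde x (h_xi xi), and
    e = z(xt,th) - z(xt,ths) is the error of the estimate th, measured against
    the ideal parameter ths of the matching condition [A3], which gives the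
    same z as theta ([psi_is_derive], [residual_split]).

    The correction terms in the equation of the integral part of th are exactly
    those that the derivative of the proportional part produces and that can be
    computed without knowing theta.  After cancellation, w = Gam^-1 th satisfies
    w' = (zd - e) alpha + q - lam th ([estimate_is_derive]), where q collects the
    derivatives of alpha and Psi in the direction nu' of x2'.  The equation for
    Psi makes q equal to psi(x,t) - psi(xt,t) times the derivative of alpha: this
    is the term assumed to be bounded for the algorithm with leakage, and it is 0
    when psi(x,t) = psi(xt,t).  If alpha does not depend on x2', q is 0 with
    Psi = 0.

    Let V = (th - ths)^T Gam^-1 (th - ths), so that V' = 2 w'^T (th - ths).  By
    [A5_sign], [A5_bound] and [A6], alpha^T (th - ths) has the sign of e and is
    comparable to e, whence 2 (zd - e) alpha^T (th - ths) <= - e^2 / D + (D / D1^2) zd^2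
    ([sector_cross_term]).

    Without leakage and with zd in L2, this bounds V and puts e in L2.  With F the primitive of phi,
    (F(psi))' = phi(psi) (- phi(psi) + zd - e) <= - phi(psi)^2 / 2 + zd^2 + e^2,
    so phi(psi) is in L2, F(psi) is bounded, hence psi is bounded by coercivity,
    and x and xi are bounded by [A1] and [A7_sol].  Both steps are instances of
    [dissipation]: if G' <= - h + k with h, k >= 0, k integrable and G bounded
    below, then h is integrable and G converges.  The convergence of F(psi(t))
    gives psi(t) -> 0 even without bounds on the derivative of psi: a nonzero
    limit would keep phi(psi)^2 away from 0 ([potential_limit_cvg0]).

    With zd only bounded, the leakage - lam th makes - lam |th - ths|^2 plus a
    constant appear in the bound on V', and W = V + (K / (2 D)) psi^2 satisfies
    W' <= - c W + C, hence is bounded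
    ([adaptive_leaky_boundedness]).

    Solutions are only continuous at t = 0 and satisfy their equations for
    t > 0; signals are therefore handled as functions continuous within the
    closed half line and derivable on the open one. *)

Set Implicit Arguments.
Unset Strict Implicit.
Unset Printing Implicit Defensive.

(** * Differential inequalities on the half line *)

Section HalfLine.
Context {R : realType}.
Implicit Types (f h k G P : R -> R).
Local Notation mu := (@lebesgue_measure R).

Lemma clamp_ge0 (x : R) : 0 <= Num.max 0 x.
Proof. by rewrite le_max lexx. Qed.

(** Precomposing with t |-> max 0 t turns continuity within the half line into
    continuity on the whole line, where the fundamental theorem of calculus
    applies around t = 0 too. *)
Lemma within_clamp (V : topologicalType) (f : R -> V) :
  {within `[0, +oo[, continuous f} -> continuous (f \o Num.max (0 : R)).
Proof.
move=> /subspace_continuousP cf x.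
have x0 : `[0 : R, +oo[%classic (Num.max 0 x).
  by rewrite /= in_itv/= clamp_ge0.
apply: cvg_comp (cf _ x0).
move=> A /= [e /= e0 eA].
have cm : {for x, continuous (fun y : R => Num.max (0 : R) y)}.
  by apply: continuous_max; [exact: cvg_cst|exact: cvg_id].
have : \forall y \near x, ball (Num.max 0 x) e (Num.max (0 : R) y).
  exact: cm (nbhsx_ballx _ _ e0).
apply: filterS => y ye; apply: eA => //=.
by rewrite in_itv/= andbT; exact: clamp_ge0.
Qed.

Lemma within_halfline_comp (U V : topologicalType) (f : R -> U) (F : U -> V) :
  continuous F -> {within `[0, +oo[, continuous f} ->
  {within `[0, +oo[, continuous (F \o f)}.
Proof.
move=> cF cf x.
exact: (@continuous_comp (subspace `[0 : R, +oo[) U V f F x (cf x) (cF _)).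
Qed.

Lemma halfline_pair (U V : topologicalType) (f : R -> U) (g : R -> V) :
  {within `[0, +oo[, continuous f} -> {within `[0, +oo[, continuous g} ->
  {within `[0, +oo[, continuous (fun t => (f t, g t))}.
Proof. by move=> cf cg x; apply: cvg_pair; [exact: cf|exact: cg]. Qed.

Lemma halfline_measurable h : {within `[0, +oo[, continuous h} ->
  measurable_fun (`[0 : R, +oo[ : set R) h.
Proof. by move=> ch; apply: subspace_continuous_measurable_fun. Qed.

Lemma is_derive_continuous (V : normedModType R) (f : R -> V) (df : V) (t : R) :
  is_derive t 1 f df -> {for t, continuous f}.
Proof. by case=> /derivable1_diffP d _; exact: differentiable_continuous. Qed.

Lemma halfline_primitive h : {within `[0, +oo[, continuous h} ->
  exists P, [/\ P 0 = 0, {within `[0, +oo[, continuous P} &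
    forall t : R, 0 < t -> is_derive t 1 P (h t)].
Proof.
move=> ch; pose H := h \o Num.max (0 : R).
have cH : continuous H := within_clamp ch.
(* Starting at -1 makes the primitive derivable, hence continuous, at 0. *)
pose Q (x : R) := (\int[mu]_(t in `[-1, x]) H t).
have iH a b : mu.-integrable `[a, b] (EFin \o H).
  apply: continuous_compact_integrable; first exact: segment_compact.
  exact: continuous_subspaceT.
have dQ (t : R) : -1 < t -> is_derive t 1 Q (H t).
  move=> t1; have [d1 d2] : derivable Q t 1 /\ derive1 Q t = H t.
    by apply: (@continuous_FTC1_closed _ _ _ _ (t + 1)) => //;
      [rewrite ltrDl|exact: cH].
  by apply: DeriveDef; [exact: d1|rewrite -derive1E].
exists (fun t => Q t - Q 0); split; first by rewrite subrr.
- apply: derivable_within_continuous => t.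
  rewrite in_itv/= andbT => t0; apply: derivableB => //.
  by case: (dQ t _) => //; apply: lt_le_trans t0; rewrite ltrN10.
- move=> t t0; have dt := dQ t (lt_trans (ltrN10 _) t0).
  have Ht : H t = h t by rewrite /H/= max_r// ltW.
  by rewrite -Ht -[H t]subr0; apply: is_deriveB.
Qed.

Lemma halfline_nondecreasing P dP :
  {within `[0, +oo[, continuous P} ->
  (forall t : R, 0 < t -> is_derive t 1 P (dP t)) ->
  (forall t : R, 0 < t -> 0 <= dP t) ->
  forall s t : R, 0 <= s -> s <= t -> P s <= P t.
Proof.
move=> cP dP_ dP0; apply: ger0_derive1_ndecry => // x; rewrite in_itv/= andbT => x0.
  by case: (dP_ x x0).
by rewrite derive1E; case: (dP_ x x0) => _ ->; exact: dP0.
Qed.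

Lemma halfline_nonincreasing P dP :
  {within `[0, +oo[, continuous P} ->
  (forall t : R, 0 < t -> is_derive t 1 P (dP t)) ->
  (forall t : R, 0 < t -> dP t <= 0) ->
  forall s t : R, 0 <= s -> s <= t -> P t <= P s.
Proof.
move=> cP dP_ dP0; apply: ler0_derive1_nincry => // x; rewrite in_itv/= andbT => x0.
  by case: (dP_ x x0).
by rewrite derive1E; case: (dP_ x x0) => _ ->; exact: dP0.
Qed.

Lemma halfline_nondecreasing_cvg P C :
  (forall s t : R, 0 <= s -> s <= t -> P s <= P t) ->
  (forall t : R, 0 <= t -> P t <= C) -> exists l : R, P t @[t --> +oo] --> l.
Proof.
move=> ndP PC; pose Q := P \o Num.max (0 : R).
exists (sup (range Q)).
have Qs : Q t @[t --> +oo] --> sup (range Q).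
  apply: nondecreasing_cvgr.
    move=> s t st; apply: ndP; first by rewrite le_max lexx.
    by rewrite ge_max !le_max lexx st orbT.
  by exists C => _ [t _ <-]; apply: PC; rewrite le_max lexx.
apply: cvg_trans Qs; apply: near_eq_cvg; near=> t.
rewrite /Q/= max_r; first by [].
by near: t; exact: nbhs_pinfty_ge.
Unshelve. all: by end_near. Qed.

(** For a nonnegative signal, finiteness of the Lebesgue integral reduces to
    boundedness of a primitive; differential inequalities then give bounds on
    integrals by monotonicity alone. *)
Lemma halfline_integrableP h P : {within `[0, +oo[, continuous h} ->
  (forall t : R, 0 <= t -> 0 <= h t) -> P 0 = 0 ->
  {within `[0, +oo[, continuous P} ->
  (forall t : R, 0 < t -> is_derive t 1 P (h t)) ->
  mu.-integrable `[0, +oo[ (EFin \o h) <->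
  exists C, forall t : R, 0 <= t -> P t <= C.
Proof.
move=> ch h0 P0 cP dP; have mh := halfline_measurable ch.
have [/in_continuous_mksetP _ cP0] := (continuous_within_itvcyP _ _).1 cP.
split=> [ih|[C PC]].
- have fi : (\int[mu]_(x in `[0%R, +oo[) (h x)%:E)%E \is a fin_num.
    exact: (@integrable_fin_num _ _ _ mu _ _ _ ih).
  exists (fine (\int[mu]_(x in `[0%R, +oo[) (h x)%:E)%E) => t.
  rewrite le_eqVlt => /predU1P[<-|t0].
    rewrite P0; apply: fine_ge0; apply: integral_ge0 => x /=.
    by rewrite in_itv/= andbT lee_fin => /h0.
  have -> : P t = fine (\int[mu]_(x in `[0%R, t]) (h x)%:E)%E.
    rewrite (@continuous_FTC2 _ h P)//.
    + by rewrite P0 sube0.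
    + by apply: continuous_subspaceW ch => x/=; rewrite !in_itv/= => /andP[->].
    + split=> //.
        by move=> x; rewrite in_itv/= => /andP[x0 _]; case: (dP x x0).
      apply: cvg_at_left_filter.
      by apply: is_derive_continuous (dP t t0).
    + move=> x; rewrite in_itv/= => /andP[x0 _]; rewrite derive1E.
      by case: (dP x x0).
  apply: fine_le => //.
    apply: (@integrable_fin_num _ _ _ mu) => //=.
    by apply: integrableS ih => // x/=; rewrite !in_itv/= => /andP[->].
  apply: ge0_subset_integral => //=; first exact/measurable_EFinP.
  - by move=> x; rewrite in_itv/= andbT lee_fin => /h0.
  - by move=> x/=; rewrite !in_itv/= => /andP[->].
- have [l Pl] : exists l : R, P t @[t --> +oo] --> l.
    apply: (@halfline_nondecreasing_cvg P C) => //.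
    apply: (@halfline_nondecreasing _ h) => // t t0; apply: h0; exact: ltW.
  apply/integrableP; split; first exact/measurable_EFinP.
  have -> : (\int[mu]_(x in `[0%R, +oo[) `|(EFin \o h) x| =
             \int[mu]_(x in `[0%R, +oo[) (h x)%:E)%E.
    apply: eq_integral => x; rewrite inE/= in_itv/= andbT => x0.
    by rewrite ger0_norm// h0.
  rewrite (@ge0_continuous_FTC2y _ h P 0 l)//.
  + by rewrite -EFinB ltry.
  + by move=> x x0; case: (dP x x0).
  + move=> x; rewrite in_itv/= andbT => x0; rewrite derive1E.
    by case: (dP x x0).
Qed.

Lemma halfline_continuousD G P : {within `[0, +oo[, continuous G} ->
  {within `[0, +oo[, continuous P} ->
  {within `[0, +oo[, continuous (fun t => G t + P t)}.
Proof. by move=> cG cP x; apply: cvgD; [exact: cG|exact: cP]. Qed.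

Lemma halfline_continuousB G P : {within `[0, +oo[, continuous G} ->
  {within `[0, +oo[, continuous P} ->
  {within `[0, +oo[, continuous (fun t => G t - P t)}.
Proof. by move=> cG cP x; apply: cvgB; [exact: cG|exact: cP]. Qed.

Lemma halfline_continuousM G P : {within `[0, +oo[, continuous G} ->
  {within `[0, +oo[, continuous P} ->
  {within `[0, +oo[, continuous (fun t => G t * P t)}.
Proof. by move=> cG cP x; apply: cvgM; [exact: cG|exact: cP]. Qed.

(** With P and Q the primitives of h and k from 0, G + P - Q is nonincreasing.
    Since Q is bounded and G is bounded below, P is bounded; G converges because
    the three monotone functions G + P - Q, P and Q do. *)
Lemma dissipation G g h k B :
  {within `[0, +oo[, continuous G} -> {within `[0, +oo[, continuous h} ->
  {within `[0, +oo[, continuous k} ->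
  (forall t : R, 0 <= t -> 0 <= h t) -> (forall t : R, 0 <= t -> 0 <= k t) ->
  (forall t : R, 0 < t -> is_derive t 1 G (g t)) ->
  (forall t : R, 0 < t -> g t <= - h t + k t) ->
  (forall t : R, 0 <= t -> B <= G t) ->
  mu.-integrable `[0, +oo[ (EFin \o k) ->
  [/\ mu.-integrable `[0, +oo[ (EFin \o h),
    exists M, forall t : R, 0 <= t -> G t <= M &
    exists l : R, G t @[t --> +oo] --> l].
Proof.
move=> cG ch ck h0 k0 dG gle BG ik.
have [P [P0 cP dP]] := halfline_primitive ch.
have [Q [Q0 cQ dQ]] := halfline_primitive ck.
have [C QC] := (halfline_integrableP ck k0 Q0 cQ dQ).1 ik.
have ndP := halfline_nondecreasing cP dP (fun t t0 => h0 t (ltW t0)).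
have ndQ := halfline_nondecreasing cQ dQ (fun t t0 => k0 t (ltW t0)).
pose E t := G t + P t - Q t.
have cE : {within `[0, +oo[, continuous E}.
  by apply: halfline_continuousB => //; exact: halfline_continuousD.
have dE (t : R) : 0 < t -> is_derive t 1 E (g t + h t - k t).
  move=> t0; have := dG t t0; have := dP t t0; have := dQ t t0 => *.
  by apply: is_deriveB; apply: is_deriveD.
have niE := halfline_nonincreasing cE dE.
have {}niE (s t : R) : 0 <= s -> s <= t -> E t <= E s.
  by apply: niE => u u0; have := gle _ u0; lra.
have P_ge0 (t : R) : 0 <= t -> 0 <= P t by move=> t0; rewrite -P0 ndP.
have Q_ge0 (t : R) : 0 <= t -> 0 <= Q t by move=> t0; rewrite -Q0 ndQ.
have E0 (t : R) : 0 <= t -> G t + P t - Q t <= G 0.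
  by move=> t0; have := niE _ _ (lexx 0) t0; rewrite /E P0 Q0; lra.
have PM (t : R) : 0 <= t -> P t <= G 0 + C - B.
  by move=> t0; have := E0 _ t0; have := QC _ t0; have := BG _ t0; lra.
split.
- by apply/(halfline_integrableP ch h0 P0 cP dP); exists (G 0 + C - B).
- exists (G 0 + C) => t t0.
  by have := E0 _ t0; have := QC _ t0; have := P_ge0 _ t0; lra.
- have [lP cvP] := halfline_nondecreasing_cvg ndP PM.
  have [lQ cvQ] := halfline_nondecreasing_cvg ndQ QC.
  have [lE cvE] : exists l : R, - E t @[t --> +oo] --> l.
    apply: (@halfline_nondecreasing_cvg _ (C - B)) => [s t s0 st|t t0].
      by rewrite lerN2 niE.
    rewrite /E; have := BG _ t0; have := P_ge0 _ t0; have := QC _ t0; lra.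
  exists (- lE - lP + lQ).
  have -> : G = (fun t => - (- E t) - P t + Q t).
    by apply/funext => t; rewrite /E; ring.
  by apply: cvgD => //; apply: cvgB => //; exact: cvgN.
Qed.

(** The function (G - C / m) exp(m t) is nonincreasing. *)
Lemma linear_differential_inequality G g (m C : R) : 0 < m ->
  {within `[0, +oo[, continuous G} ->
  (forall t : R, 0 < t -> is_derive t 1 G (g t)) ->
  (forall t : R, 0 < t -> g t <= - m * G t + C) ->
  exists M, forall t : R, 0 <= t -> G t <= M.
Proof.
move=> m0 cG dG gle.
pose e (t : R) := expR (m * t).
have de (t : R) : is_derive t 1 e (m * e t).
  have d1 : is_derive t 1 (fun t : R => m * t) m.
    by rewrite -[X in is_derive _ _ _ X]mulr1; apply: is_deriveZ.
  rewrite mulrC; exact: is_derive1_comp.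
pose E t := (G t - C / m) * e t.
have dE (t : R) : 0 < t -> is_derive t 1 E
    ((G t - C / m) * (m * e t) + e t * (g t - 0)).
  move=> t0; have := dG t t0 => ?.
  by apply: is_deriveM.
have cE : {within `[0, +oo[, continuous E}.
  apply: halfline_continuousM.
    apply: halfline_continuousB => //; apply: continuous_subspaceT => x.
    exact: cvg_cst.
  by apply: continuous_subspaceT => x; apply: is_derive_continuous (de x).
have niE (t : R) : 0 <= t -> E t <= E 0.
  apply: (halfline_nonincreasing cE dE) => // s s0.
  have -> : (G s - C / m) * (m * e s) + e s * (g s - 0) =
     e s * (g s - (- m * G s + C)) by field; rewrite gt_eqF.
  by rewrite pmulr_rle0 ?expR_gt0// subr_le0 gle.
exists (C / m + `|G 0 - C / m|) => t t0.
rewrite -lerBlDl -(@ler_pM2r _ (e t)) ?expR_gt0//.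
apply: le_trans (niE _ t0) _; rewrite /E {1}/e mulr0 expR0 mulr1.
apply: le_trans (ler_norm _) _; rewrite ler_peMr// /e.
by rewrite -expR0 ler_expR mulr_ge0// ltW.
Qed.

End HalfLine.

(** * The potential of the feedback nonlinearity *)

Section Potential.
Context {R : realType}.
Implicit Types (phi F q : R -> R).
Local Notation mu := (@lebesgue_measure R).

(** Both cases of the oriented integral are differences of the integrals of phi
    from a common base point below s and 0, so that the derivative at 0 needs no
    gluing. *)
Lemma prim0_is_derive phi : continuous phi ->
  forall s : R, is_derive s 1 (prim0 phi) (phi s).
Proof.
move=> cphi s; pose a := Num.min s 0 - 1.
have [as_ a0] : a < s /\ a < 0.
  by split; rewrite /a ltrBlDr gt_min ltrDl ltr01 ?orbT.
have iphi x y : mu.-integrable `[x, y] (EFin \o phi).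
  apply: continuous_compact_integrable; first exact: segment_compact.
  exact: continuous_subspaceT.
pose Q (x : R) := \int[mu]_(t in `[a, x]) phi t.
have dQ : is_derive s 1 Q (phi s).
  have [d1 d2] : derivable Q s 1 /\ derive1 Q s = phi s.
    by apply: (@continuous_FTC1_closed _ _ _ _ (s + 1)) => //;
      [rewrite ltrDl|exact: cphi].
  by apply: DeriveDef; [exact: d1|rewrite -derive1E].
have QE x : a < x -> Q x - Q 0 = prim0 phi x.
  move=> ax; rewrite /prim0 /Q; case: (leP 0 x) => [x0|x0].
    rewrite (@Rintegral_itvB _ _ _ _ 0)// ?bnd_simp ?(ltW a0)//.
    rewrite Rintegral_itv_obnd_cbnd//; apply: integrableS (iphi 0 x) => //.
    exact: subset_itv_oc_cc.
  rewrite -opprB (@Rintegral_itvB _ _ _ _ x)// ?bnd_simp ?(ltW ax) ?(ltW x0)//.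
  rewrite Rintegral_itv_obnd_cbnd//; apply: integrableS (iphi x 0) => //.
  exact: subset_itv_oc_cc.
apply: (@near_eq_is_derive _ _ _ (fun x => Q x - Q 0)).
  near=> x; apply: QE; near: x; exact: lt_nbhsr.
by rewrite -[phi s]subr0; apply: is_deriveB.
Unshelve. all: by end_near. Qed.

Lemma prim00 phi : prim0 phi 0 = 0.
Proof. by rewrite /prim0 lexx set_itv1 Rintegral_set1. Qed.

Lemma prim0_gt0 phi : continuous phi -> (forall s, s != 0 -> 0 < phi s * s) ->
  forall s, s != 0 -> 0 < prim0 phi s.
Proof.
move=> cphi sphi s; have dF := prim0_is_derive cphi.
have cF : continuous (prim0 phi) by move=> x; apply: is_derive_continuous (dF x).
case: (ltgtP s 0) => // s0 _.
- have [c] := MVT s0 (fun x _ => dF x) (continuous_subspaceT cF).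
  rewrite in_itv/= prim00 => /andP[sc c0] /eqP.
  rewrite sub0r eqr_oppLR => /eqP ->.
  have := sphi c (negbT (lt_eqF c0)); rewrite nmulr_lgt0// => pc.
  by rewrite sub0r mulrN opprK nmulr_lgt0.
- have [c] := MVT s0 (fun x _ => dF x) (continuous_subspaceT cF).
  rewrite in_itv/= prim00 !subr0 => /andP[c0 cs] ->.
  have := sphi c (negbT (gt_eqF c0)); rewrite pmulr_lgt0// => pc.
  by rewrite pmulr_rgt0.
Qed.

Lemma prim0_ge0 phi : continuous phi -> (forall s, s != 0 -> 0 < phi s * s) ->
  forall s, 0 <= prim0 phi s.
Proof.
move=> cphi sphi s; have [->|s0] := eqVneq s 0; first by rewrite prim00.
by rewrite ltW// prim0_gt0.
Qed.

Lemma coercive_bounded F (M : R) : F s @[s --> +oo] --> +oo ->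
  F s @[s --> -oo] --> +oo -> exists B : R, forall s, F s <= M -> `|s| <= B.
Proof.
move=> /cvgryPgt /(_ M) [a [_ aM]] /cvgryPgt /(_ M) [b [_ bM]].
exists (`|a| + `|b|) => s sM; rewrite ler_norml; apply/andP; split.
- rewrite leNgt; apply/negP => sb.
  have /bM : s < b.
    by apply: lt_le_trans sb _; have := ler_norm (- b); have := normr_ge0 a;
      rewrite normrN; lra.
  by rewrite ltNge sM.
- rewrite leNgt; apply/negP => sb.
  have /aM : a < s.
    by apply: le_lt_trans sb; have := ler_norm a; have := normr_ge0 b; lra.
  by rewrite ltNge sM.
Qed.

Lemma positive_off_zero_lbound F (e B : R) : continuous F ->
  (forall s, s != 0 -> 0 < F s) -> 0 < e ->
  exists2 c, 0 < c & forall s, e <= `|s| -> `|s| <= B -> c <= F s.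
Proof.
move=> cF F0 e0; have [Be|eB] := ltP B e.
  by exists 1 => // s es sB; have := le_trans es sB; rewrite leNgt Be.
have [c ce cP] := EVT_min eB (continuous_subspaceT cF).
have [|c' ce' cP'] := @EVT_min _ F (- B) (- e) _ (continuous_subspaceT cF).
  by rewrite lerN2.
exists (Num.min (F c) (F c')).
  rewrite lt_min !F0//.
    by move: ce'; rewrite in_itv/= => /andP[_]; apply: contraTneq => ->; lra.
  by move: ce; rewrite in_itv/= => /andP[+ _]; apply: contraTneq => ->; lra.
move=> s; case: (leP 0 s) => s0 es sB.
  rewrite ge_min; apply/orP; left; apply: cP.
  by move: es sB; rewrite in_itv/= ger0_norm// => -> ->.
rewrite ge_min; apply/orP; right; apply: cP'.
by move: es sB; rewrite in_itv/= ltr0_norm// lerNl lerNr => -> ->.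
Qed.

(** A positive limit of F along s would keep s away from 0, hence q along s above
    a positive constant, which contradicts integrability.  So the limit is 0,
    and F has a positive lower bound on the part of [-B, B] at distance at least
    eps from 0. *)
Lemma potential_limit_cvg0 F q (s : R -> R) (B L : R) :
  continuous F -> F 0 = 0 -> (forall v, v != 0 -> 0 < F v) ->
  continuous q -> (forall v, 0 <= q v) -> (forall v, v != 0 -> 0 < q v) ->
  {within `[0, +oo[, continuous s} -> (forall t : R, 0 <= t -> `|s t| <= B) ->
  F (s t) @[t --> +oo] --> L ->
  mu.-integrable `[0, +oo[ (EFin \o (q \o s)) ->
  s t @[t --> +oo] --> (0 : R).
Proof.
move=> cF F0 Fpos cq q_ge0 qpos cs sB FL iq.
have L0 : L <= 0.
  rewrite leNgt; apply/negP => L0.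
  have [e /= e0 eF] : \forall v \near (0 : R), F v < L / 2.
    by apply: (cvgr_lt _ (cF 0)); rewrite F0 divr_gt0.
  have [c c0 cP] := positive_off_zero_lbound B cq qpos e0.
  have [T [_ TF]] : \forall t \near +oo, L / 2 < F (s t).
    by apply: (cvgr_gt _ FL); rewrite ltr_pdivrMr// ltr_pMr// ltr1n.
  have cqs : {within `[0, +oo[, continuous (q \o s)}.
    exact: within_halfline_comp.
  have [P [P0 cP' dP]] := halfline_primitive cqs.
  have [C PC] := (halfline_integrableP cqs (fun t _ => q_ge0 _) P0 cP' dP).1 iq.
  pose T0 := `|T| + 1.
  have T00 : 0 <= T0 by rewrite addr_ge0.
  have TT0 : T < T0 by have := ler_norm T; rewrite /T0; lra.
  have qc t : T0 <= t -> c <= q (s t).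
    move=> Tt; apply: cP; last by apply: sB; exact: le_trans Tt.
    rewrite leNgt; apply/negP => se.
    have : F (s t) < L / 2 by apply: eF; rewrite /= sub0r normrN.
    by rewrite ltNge ltW// TF// (lt_le_trans TT0).
  have lowP t : T0 <= t -> P T0 + c * (t - T0) <= P t.
    rewrite le_eqVlt => /predU1P[<-|Tt]; first by rewrite subrr mulr0 addr0.
    have [||u] := @MVT _ P (q \o s) _ _ Tt.
    - move=> u; rewrite in_itv/= => /andP[Tu _].
      by apply: dP; exact: le_lt_trans Tu.
    - apply: continuous_subspaceW cP' => u/=; rewrite !in_itv/= => /andP[Tu _].
      by rewrite andbT (le_trans T00).
    - rewrite in_itv/= => /andP[Tu _] PE.
      rewrite -lerBrDl PE ler_pM2r ?subr_gt0//.
      by apply: qc; exact: ltW.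
  (* The lower bound of slope c exceeds C at this time. *)
  have := lowP (T0 + (C - P T0 + 1) / c).
  have PT0 : P T0 <= C by apply: PC.
  have d0 : 0 <= (C - P T0 + 1) / c by rewrite divr_ge0 ?(ltW c0)//; lra.
  have /PC : 0 <= T0 + (C - P T0 + 1) / c by rewrite addr_ge0.
  rewrite lerDl => PC1 /(_ d0); rewrite addrAC subrr add0r.
  by rewrite mulrC divfK ?gt_eqF//; lra.
apply/cvgrPdist_lt => e e0.
have [c c0 cP] := positive_off_zero_lbound B cF Fpos e0.
have [T [_ TF]] : \forall t \near +oo, F (s t) < c.
  by apply: (cvgr_lt _ FL); exact: le_lt_trans c0.
near=> t; rewrite sub0r normrN ltNge; apply/negP => es.
have : c <= F (s t) by apply: cP => //; apply: sB; near: t; exact: nbhs_pinfty_ge.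
have Tt : T < t by near: t; exists T; split; rewrite ?num_real.
by rewrite leNgt TF.
Unshelve. all: by end_near. Qed.

End Potential.

(** * Derivatives and continuity along curves *)

Section Curves.
Context {R : realType}.

Lemma dotvE (d : nat) (a b : 'cV[R]_d) : dotv a b = \sum_i a i 0 * b i 0.
Proof. by rewrite /dotv mxE; apply: eq_bigr => i _; rewrite mxE. Qed.

Lemma continuous_mx (T : topologicalType) (p q : nat) (M : T -> 'M[R]_(p, q)) :
  (forall i j, continuous (fun t => M t i j)) -> continuous M.
Proof.
move=> cM t; apply/cvgrPdist_le => /= e e0; near=> s.
rewrite /Num.Def.normr/= mx_normrE (bigmax_le _ (ltW e0))//= => i _.
rewrite !mxE/=.
move: i; near: s; apply: filter_forall => /= i.
exact: ((cvgrPdist_le _ _).1 (cM i.1 i.2 t)).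
Unshelve. all: by end_near. Qed.

Lemma continuous_entry (T : topologicalType) (p q : nat) (M : T -> 'M[R]_(p, q)) :
  continuous M -> forall i j, continuous (fun t => M t i j).
Proof.
move=> cM i j t; apply: (@continuous_comp _ _ _ M (fun N => N i j)).
  exact: cM.
exact: coord_continuous.
Qed.

Lemma continuous_sum (T : topologicalType) (V : normedModType R) (n : nat)
  (F : 'I_n -> T -> V) : (forall i, continuous (F i)) ->
  continuous (fun x => \sum_i F i x).
Proof. by move=> cF; apply: continuous_big => // ; exact: add_continuous. Qed.

Lemma continuous_scale (T : topologicalType) (V : normedModType R)
  (s : T -> R) (f : T -> V) : continuous s -> continuous f ->
  continuous (fun x => s x *: f x).
Proof. by move=> cs cf x; apply: cvgZ; [exact: cs|exact: cf]. Qed.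

Lemma linear_mx_continuous (V : normedModType R) (p q : nat)
  (L : 'M[R]_(p, q) -> V) : linear L -> continuous L.
Proof.
move=> linL.
pose LL := GRing.isLinear.Build _ _ _ _ _ linL.
pose Ll : {linear 'M[R]_(p, q) -> V} := HB.pack L LL.
have -> : L = fun M => \sum_i \sum_j M i j *: L (delta_mx i j).
  apply/funext => M; rewrite -[L]/(Ll : _ -> _) {1}[M]matrix_sum_delta.
  rewrite linear_sum; apply: eq_bigr => i _; rewrite linear_sum.
  by apply: eq_bigr => j _; rewrite linearZ.
apply: continuous_sum => i; apply: continuous_sum => j.
apply: continuous_scale; first exact: coord_continuous.
exact: cst_continuous.
Qed.

Lemma is_derive_mx (p q : nat) (M : R -> 'M[R]_(p, q)) (M' : 'M[R]_(p, q)) (t : R) :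
  (forall i j, is_derive t 1 (fun s => M s i j) (M' i j)) -> is_derive t 1 M M'.
Proof.
move=> dM; have dM_ : derivable M t 1.
  by apply/derivable_mxP => i j; case: (dM i j).
apply: DeriveDef => //; rewrite derive_mx//.
by apply/matrixP => i j; rewrite mxE; case: (dM i j).
Qed.

Lemma is_derive_comp_diff (U V : normedModType R) (G : U -> V) (c : R -> U)
  (c' : U) (t : R) : differentiable G (c t) -> is_derive t 1 c c' ->
  is_derive t 1 (G \o c) ('d G (c t) c').
Proof.
move=> dG dc; have dc1 : differentiable c t.
  by apply/derivable1_diffP; case: dc.
have dGc : differentiable (G \o c) t by exact: differentiable_comp.
apply: DeriveDef; first exact/derivable1_diffP.
rewrite deriveE// diff_comp//=; congr ('d G (c t) _).
by rewrite -deriveE//; case: dc.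
Qed.

Lemma is_derive_linear (V : normedModType R) (p q : nat)
  (L : 'M[R]_(p, q) -> V) (c : R -> 'M[R]_(p, q)) (c' : 'M[R]_(p, q)) (t : R) : linear L ->
  is_derive t 1 c c' -> is_derive t 1 (fun s => L (c s)) (L c').
Proof.
move=> linL dc; have cL := linear_mx_continuous linL.
pose LL := GRing.isLinear.Build _ _ _ _ _ linL.
pose Ll : {linear 'M[R]_(p, q) -> V} := HB.pack L LL.
have -> : L c' = 'd Ll (c t) c' by rewrite diff_lin.
apply: is_derive_comp_diff => //; exact: linear_differentiable.
Qed.

Lemma is_derive_entry (p q : nat) (M : R -> 'M[R]_(p, q)) (M' : 'M[R]_(p, q)) (t : R) i j :
  is_derive t 1 M M' -> is_derive t 1 (fun s => M s i j) (M' i j).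
Proof.
by apply: (@is_derive_linear R^o _ _ (fun N => N i j)) => a N N'; rewrite !mxE.
Qed.

Lemma is_derive_scale (p q : nat) (s : R -> R) (s' : R) (M : R -> 'M[R]_(p, q))
  (M' : 'M[R]_(p, q))  (t : R) : is_derive t 1 s s' -> is_derive t 1 M M' ->
  is_derive t 1 (fun u => s u *: M u) (s' *: M t + s t *: M').
Proof.
move=> ds dM; apply: is_derive_mx => i j; rewrite !mxE.
have dMij := is_derive_entry i j dM.
have -> : (fun u => (s u *: M u) i j) = s * (fun u => M u i j).
  by apply/funext => u; rewrite mxE.
apply: is_derive_eq (is_deriveM ds dMij) _.
by rewrite addrC; congr (_ + _); exact: mulrC.
Qed.

Lemma is_derive_dotv (d : nat) (a b : R -> 'cV[R]_d) (a' b' : 'cV[R]_d) (t : R) :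
  is_derive t 1 a a' -> is_derive t 1 b b' ->
  is_derive t 1 (fun u => dotv (a u) (b u)) (dotv a' (b t) + dotv (a t) b').
Proof.
move=> da db.
have -> : (fun u => dotv (a u) (b u)) =
    \sum_i ((fun u => a u i 0) * (fun u => b u i 0)).
  by apply/funext => u; rewrite dotvE fct_sumE.
apply: is_derive_eq.
  apply: is_derive_sum => i.
  exact: is_deriveM (is_derive_entry i 0 da) (is_derive_entry i 0 db).
rewrite !dotvE -big_split/=; apply: eq_bigr => i _.
by rewrite addrC; congr (_ + _); rewrite /GRing.scale/= mulrC.
Qed.

Lemma C1_cst (U V : normedModType R) (a : V) :
  C1 (fun _ : U => a).
Proof.
split=> [p|v]; first exact: differentiable_cst.
rewrite (_ : (fun p => _) = cst 0); first exact: cst_continuous.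
by apply/funext => p; rewrite diff_cst.
Qed.

Lemma DxD (U V : normedModType R) (F : U -> R -> V) x (t : R) u v :
  Dx F x t (u + v) = Dx F x t u + Dx F x t v.
Proof. exact: linearD. Qed.

Lemma DxZ (U V : normedModType R) (F : U -> R -> V) x (t a : R) v :
  Dx F x t (a *: v) = a *: Dx F x t v.
Proof. exact: linearZ. Qed.

(** The partial differentials are restrictions of the total differential, so that
    their continuity and the chain rule follow from the C1 assumption on the
    uncurried function. *)
Lemma DxE (U V : normedModType R) (F : U -> R -> V) x t v :
  differentiable (fun p : U * R => F p.1 p.2) (x, t) ->
  Dx F x t v = 'd (fun p : U * R => F p.1 p.2) (x, t) (v, 0).
Proof.
move=> dF; rewrite /Dx.
have -> : F ^~ t = (fun p : U * R => F p.1 p.2) \o (fun y => (y, t)) by [].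
have d1 : differentiable (fun y : U => (y, t)) x.
  by apply: differentiable_pair; exact: ex_diff.
rewrite diff_comp//= diff_pair//.
by rewrite diff_val diff_cst.
Qed.

Lemma DtE (U V : normedModType R) (F : U -> R -> V) x t :
  differentiable (fun p : U * R => F p.1 p.2) (x, t) ->
  Dt F x t = 'd (fun p : U * R => F p.1 p.2) (x, t) (0, 1).
Proof.
move=> dF; rewrite /Dt.
have -> : F x = (fun p : U * R => F p.1 p.2) \o (fun s => (x, s)) by [].
have d1 : differentiable (fun s : R => (x, s)) t.
  by apply: differentiable_pair; exact: ex_diff.
rewrite derive1E'; last exact: differentiable_comp.
rewrite diff_comp//= diff_pair//.
by rewrite !diff_val.
Qed.

Lemma is_derive_along (U V : normedModType R) (F : U -> R -> V)
  (x : R -> U) (x' : U) (t : R) : C1 (fun p : U * R => F p.1 p.2) ->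
  is_derive t 1 x x' ->
  is_derive t 1 (fun s => F (x s) s) (Dx F (x t) t x' + Dt F (x t) t).
Proof.
move=> [dF _] dx; rewrite DxE// DtE// -linearD.
have -> : (x', 0) + (0, 1) = (x', 1) :> U * R.
  by congr pair; rewrite /= ?addr0 ?add0r.
apply: (@is_derive_comp_diff _ _ (fun p : U * R => F p.1 p.2)
  (fun s => (x s, s))) => //.
have dx1 : differentiable x t by apply/derivable1_diffP; case: dx.
have dp : differentiable (fun s : R => (x s, s)) t.
  exact: differentiable_pair.
apply: DeriveDef; first exact/derivable1_diffP.
rewrite deriveE// diff_pair// diff_val -deriveE//.
by case: dx => _ ->.
Qed.

Lemma C1_continuous (U V : normedModType R) (F : U -> V) : C1 F -> continuous F.
Proof. by move=> [dF _] x; exact: differentiable_continuous. Qed.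

(** The C1 assumption gives continuity of the differential in each fixed
    direction only; decomposing v over the canonical basis gives joint
    continuity in finite dimension. *)
Lemma continuous_Dx (T : topologicalType) (V : normedModType R) (n : nat)
  (F : 'cV[R]_n -> R -> V) (x v : T -> 'cV[R]_n) (s : T -> R) :
  C1 (fun p : 'cV[R]_n * R => F p.1 p.2) ->
  continuous x -> continuous s -> continuous v ->
  continuous (fun t => Dx F (x t) (s t) (v t)).
Proof.
move=> [dF cF] cx cs cv.
have -> : (fun t => Dx F (x t) (s t) (v t)) =
  fun t => \sum_i v t i 0 *:
    'd (fun p : 'cV[R]_n * R => F p.1 p.2) (x t, s t) (delta_mx i 0, 0).
  apply/funext => t; rewrite {1}[v t]matrix_sum_delta.
  rewrite /Dx linear_sum; apply: eq_bigr => i _.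
  by rewrite big_ord1 linearZ -DxE.
apply: continuous_sum => i; apply: continuous_scale.
  exact: continuous_entry cv i 0.
move=> t.
apply: (@continuous_comp _ _ _ (fun t => (x t, s t))
  (fun p => 'd (fun p : 'cV[R]_n * R => F p.1 p.2) p (delta_mx i 0, 0))).
  exact: (cvg_pair (cx t) (cs t)).
exact: cF.
Qed.

End Curves.

(** * Quadratic forms and cross terms *)

Section QuadraticForms.
Context {R : realType}.

Lemma dotvC (d : nat) (a b : 'cV[R]_d) : dotv a b = dotv b a.
Proof. by rewrite !dotvE; apply: eq_bigr => i _; rewrite mulrC. Qed.

Lemma dotvDl (d : nat) (a b c : 'cV[R]_d) : dotv (a + b) c = dotv a c + dotv b c.
Proof. by rewrite /dotv linearD mulmxDl mxE. Qed.

Lemma dotvZl (d : nat) (k : R) (a b : 'cV[R]_d) : dotv (k *: a) b = k * dotv a b.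
Proof. by rewrite /dotv linearZ -scalemxAl mxE. Qed.

Lemma dotvZr (d : nat) (k : R) (a b : 'cV[R]_d) : dotv a (k *: b) = k * dotv a b.
Proof. by rewrite dotvC dotvZl dotvC. Qed.

Lemma dotvBl (d : nat) (a b c : 'cV[R]_d) : dotv (a - b) c = dotv a c - dotv b c.
Proof. by rewrite dotvDl -scaleN1r dotvZl mulN1r. Qed.

Lemma dotvBr (d : nat) (a b c : 'cV[R]_d) : dotv a (b - c) = dotv a b - dotv a c.
Proof. by rewrite dotvC dotvBl !(dotvC a). Qed.

Lemma dotv_mulmx (d : nat) (A : 'M[R]_d) (a b : 'cV[R]_d) :
  dotv a (A *m b) = dotv (A^T *m a) b.
Proof. by rewrite /dotv trmx_mul trmxK mulmxA. Qed.

Lemma mx_entry_norm (p q : nat) (M : 'M[R]_(p, q)) i j : `|M i j| <= `|M|.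
Proof.
rewrite [leRHS]/Num.Def.normr/= mx_normrE.
exact: (le_bigmax _ (fun ij => `|M ij.1 ij.2|) (i, j)).
Qed.

Lemma mx_norm_lub (p q : nat) (M : 'M[R]_(p, q)) (C : R) : 0 <= C ->
  (forall i j, `|M i j| <= C) -> `|M| <= C.
Proof.
move=> C0 MC; rewrite [leLHS]/Num.Def.normr/= mx_normrE.
by apply: bigmax_le => // i _.
Qed.

Lemma dotv_ge0 (d : nat) (a : 'cV[R]_d) : 0 <= dotv a a.
Proof. by rewrite dotvE sumr_ge0// => i _; rewrite -expr2 sqr_ge0. Qed.

Lemma sqr_entry_le_dotv (d : nat) (a : 'cV[R]_d) i : a i 0 ^+ 2 <= dotv a a.
Proof.
rewrite dotvE (bigD1 i)//= -expr2 lerDl sumr_ge0// => j _.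
by rewrite -expr2 sqr_ge0.
Qed.

Lemma sqr_norm_le (d : nat) (a : 'cV[R]_d) (C : R) : 0 <= C ->
  (forall i, a i 0 ^+ 2 <= C) -> `|a| ^+ 2 <= C.
Proof.
move=> C0 aC; rewrite -(sqr_sqrtr C0) lerXn2r ?nnegrE ?sqrtr_ge0//.
apply: mx_norm_lub => [|i j]; first exact: sqrtr_ge0.
by rewrite ord1 -sqrtr_sqr ler_sqrt.
Qed.

Lemma sqr_norm_le_dotv (d : nat) (a : 'cV[R]_d) : `|a| ^+ 2 <= dotv a a.
Proof. by apply: sqr_norm_le (dotv_ge0 a) _ => i; exact: sqr_entry_le_dotv. Qed.

Lemma dotv_le_norm (d : nat) (a b : 'cV[R]_d) :
  `|dotv a b| <= d%:R * (`|a| * `|b|).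
Proof.
rewrite dotvE (le_trans (ler_norm_sum _ _ _))//.
have -> : d%:R * (`|a| * `|b|) = \sum_(i < d) `|a| * `|b|.
  by rewrite sumr_const card_ord mulr_natl.
by apply: ler_sum => i _; rewrite normrM ler_pM// mx_entry_norm.
Qed.

Lemma dotv_mul_le (d : nat) (A : 'M[R]_d) : exists2 C, 0 < C &
  forall a, dotv (A *m a) a <= C * dotv a a.
Proof.
have [k k0 kA] : exists2 k, 0 < k & forall a : 'cV[R]_d, `|A *m a| <= k * `|a|.
  have linA : linear (fun a : 'cV[R]_d => A *m a).
    by move=> c u v; rewrite linearP.
  pose LL := GRing.isLinear.Build _ _ _ _ _ linA.
  pose Ll : {linear 'cV[R]_d -> 'cV[R]_d} := HB.pack (mulmx A) LL.
  by apply: (@linear_lipschitz _ _ _ Ll); exact: linear_mx_continuous linA.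
exists (d%:R * k + 1) => [|a].
  by rewrite ltr_wpDl// mulr_ge0// ltW.
apply: le_trans (ler_norm _) _; apply: le_trans (dotv_le_norm _ _) _.
have le1 : `|A *m a| * `|a| <= k * dotv a a.
  apply: (@le_trans _ _ (k * `|a| * `|a|)); first by rewrite ler_wpM2r.
  by rewrite -mulrA -expr2 ler_pM2l// sqr_norm_le_dotv.
rewrite mulrDl mul1r -mulrA ler_wpDr ?dotv_ge0//.
by rewrite ler_wpM2l.
Qed.

Lemma posdef_unit (d : nat) (G : 'M[R]_d) : sym_posdef G -> G \in unitmx.
Proof.
move=> [_ pG]; rewrite unitmxE unitfE; apply/negP => /det0P[v v0 vG].
have vT0 : v^T != 0 by apply: contra_neq v0 => /(congr1 trmx); rewrite trmxK trmx0.
by have := pG _ vT0; rewrite /dotv trmxK mulmxA vG mul0mx mxE ltxx.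
Qed.

Lemma posdef_ge0 (d : nat) (G : 'M[R]_d) v : sym_posdef G -> 0 <= dotv v (G *m v).
Proof.
move=> [_ pG]; have [->|v0] := eqVneq v 0; last by rewrite ltW ?pG.
by rewrite mulmx0 /dotv mulmx0 mxE.
Qed.

(** Nonnegativity of the form at (u^T G u) v - (u^T G v) u. *)
Lemma posdef_cauchy_schwarz (d : nat) (G : 'M[R]_d) u v : sym_posdef G ->
  dotv u (G *m v) ^+ 2 <= dotv u (G *m u) * dotv v (G *m v).
Proof.
move=> pG; have [symG _] := pG.
have [->|u0] := eqVneq u 0.
  by rewrite dotv_mulmx mulmx0 /dotv !(trmx0, mul0mx) mxE expr0n mul0r.
have uG : 0 < dotv u (G *m u) by case: pG => _; apply.
have uGv : dotv v (G *m u) = dotv u (G *m v).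
  by rewrite dotv_mulmx symG dotvC.
have := posdef_ge0 (dotv u (G *m u) *: v - dotv u (G *m v) *: u) pG.
rewrite mulmxBr -!scalemxAr !(dotvBl, dotvBr, dotvZl, dotvZr) uGv.
set a := dotv u _ in uG *; set b := dotv u _; set c := dotv v _ => ge0.
have : 0 <= a * (a * c - b ^+ 2) by lra.
by rewrite pmulr_rge0// subr_ge0.
Qed.

(** Each coordinate of G v is e_i^T G v, which Cauchy-Schwarz for the form G bounds
    by the i-th diagonal entry of G times the form at v.  Applied to
    v = G^-1 eta, it says that the Lyapunov function controls the norm of eta. *)
Lemma posdef_norm_le (d : nat) (G : 'M[R]_d) : sym_posdef G ->
  exists2 C, 0 < C & forall v, `|G *m v| ^+ 2 <= C * dotv v (G *m v).
Proof.
move=> pG; pose e i : 'cV[R]_d := delta_mx i 0.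
have Gii i : 0 <= dotv (e i) (G *m e i) by exact: posdef_ge0.
have S0 (P : pred 'I_d) : 0 <= \sum_(i | P i) dotv (e i) (G *m e i).
  by apply: sumr_ge0 => i _; exact: Gii.
exists (\sum_i dotv (e i) (G *m e i) + 1) => [|v].
  by apply: ltr_wpDl; [exact: S0|exact: ltr01].
have v0 : 0 <= dotv v (G *m v) by exact: posdef_ge0.
apply: sqr_norm_le => [|i].
  by apply: mulr_ge0 => //; apply: addr_ge0 => //; exact: S0.
have -> : (G *m v) i 0 = dotv (e i) (G *m v).
  by rewrite /dotv trmx_delta -rowE [RHS]mxE.
apply: le_trans (posdef_cauchy_schwarz (e i) v pG) _.
by rewrite ler_wpM2r// (bigD1 i)//= -addrA lerDl addr_ge0.
Qed.

Lemma posdef_le_dotv (d : nat) (G : 'M[R]_d) : sym_posdef G ->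
  exists2 C, 0 < C & forall v, dotv v (G *m v) <= C * dotv (G *m v) (G *m v).
Proof.
move=> pG; have [C C0 CP] := dotv_mul_le (invmx G); exists C => // v.
by have := CP (G *m v); rewrite mulKmx// posdef_unit.
Qed.

(** Since e and a have the same sign, e a = |e| |a| >= e^2 / D, while
    2 |zd| |a| <= 2 |zd| |e| / D1 is absorbed by Young's inequality into half of
    the dissipation 2 e^2 / D. *)
Lemma sector_cross_term (D D1 zd e a : R) : 0 < D -> 0 < D1 -> 0 <= e * a ->
  `|e| <= D * `|a| -> D1 * `|a| <= `|e| ->
  2 * ((zd - e) * a) <= - (D^-1 * e ^+ 2) + D / D1 ^+ 2 * zd ^+ 2.
Proof.
move=> D0 D10 ea0 eD D1a.
have eaE : e * a = `|e| * `|a| by rewrite -normrM ger0_norm.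
have e2 : e ^+ 2 = `|e| ^+ 2 by rewrite real_normK ?num_real.
have ea_lb : D^-1 * e ^+ 2 <= e * a.
  by rewrite eaE e2 expr2 ler_pdivrMl// mulrCA ler_wpM2l.
have a_ub : `|a| <= `|e| / D1 by rewrite ler_pdivlMr// mulrC.
have zda : zd * a <= `|zd| * (`|e| / D1).
  apply: le_trans (ler_norm _) _; rewrite normrM ler_wpM2l//.
have sq : 0 <= D * (D^-1 * `|e| - `|zd| / D1) ^+ 2.
  by rewrite mulr_ge0 ?sqr_ge0// ltW.
have sqE : D * (D^-1 * `|e| - `|zd| / D1) ^+ 2 =
   D^-1 * e ^+ 2 - 2 * (`|zd| * (`|e| / D1)) + D / D1 ^+ 2 * zd ^+ 2.
  rewrite e2 -[zd ^+ 2]real_normK ?num_real//.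
  by field; rewrite !gt_eqF.
rewrite mulrBl; lra.
Qed.

End QuadraticForms.

(** * Bounded and square-integrable signals *)

Section Signals.
Context {R : realType}.
Implicit Types (s k phi : R -> R).
Local Notation mu := (@lebesgue_measure R).

Lemma LinfP (V : normedModType R) (s : R -> V) :
  Linf s <-> exists M, forall t : R, 0 <= t -> `|s t| <= M.
Proof.
split=> [[M [_ MP]]|[M MP]].
  exists (M + 1) => t t0; apply: (MP (M + 1)); first by rewrite ltrDl.
  by rewrite /= in_itv/= t0.
exists M; split; first exact: num_real.
move=> N MN t /=; rewrite in_itv/= andbT => t0.
exact: le_trans (MP t t0) (ltW MN).
Qed.

(** The value at t = 0 is a single number; this matters for signals, such as
    [derive1] of a solution, that are controlled for t > 0 only. *)
Lemma Linf_pos (V : normedModType R) (s : R -> V) M :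
  (forall t : R, 0 < t -> `|s t| <= M) -> Linf s.
Proof.
move=> sM; apply/LinfP; exists (`|s 0| + `|M|) => t.
rewrite le_eqVlt => /predU1P[<-|t0]; first by rewrite lerDl.
by apply: le_trans (sM t t0) _; rewrite ler_wpDl// ler_norm.
Qed.

Lemma halfline_integrable_lincomb k1 k2 (a b : R) :
  mu.-integrable `[0, +oo[ (EFin \o k1) ->
  mu.-integrable `[0, +oo[ (EFin \o k2) ->
  mu.-integrable `[0, +oo[ (EFin \o (fun t => a * k1 t + b * k2 t)).
Proof.
move=> i1 i2.
have := integrableD _ (integrableZl _ a i1) (integrableZl _ b i2).
exact.
Qed.

Lemma halfline_integrableZ k (a : R) :
  mu.-integrable `[0, +oo[ (EFin \o k) ->
  mu.-integrable `[0, +oo[ (EFin \o (fun t => a * k t)).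
Proof. by move=> ik; exact: (integrableZl _ a ik). Qed.

Lemma L2E s : L2 s <-> mu.-integrable `[0, +oo[ (EFin \o (fun t => s t ^+ 2)).
Proof.
rewrite /L2; suff -> : (fun t => (`|s t| ^+ 2)%:E) = EFin \o (fun t => s t ^+ 2).
  by [].
by apply/funext => t /=; rewrite real_normK ?num_real.
Qed.

Lemma halfline_measurable_pos s s' : {within `[0, +oo[, continuous s'} ->
  (forall t : R, 0 < t -> s t = s' t) -> measurable_fun (`[0 : R, +oo[ : set R) s.
Proof.
move=> cs' ss'; apply/measurable_fun_itv_obnd_cbndP.
apply: (eq_measurable_fun s') => [t|].
  by rewrite inE/= in_itv/= andbT => /ss' ->.
apply: measurable_funS (halfline_measurable cs') => //.
by move=> t/=; rewrite !in_itv/= !andbT => /ltW.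
Qed.

(** The signal s is compared for t > 0 only, since {0} is negligible; the
    continuous s' is there for measurability. *)
Lemma L2_dominated s s' k : {within `[0, +oo[, continuous s'} ->
  (forall t : R, 0 < t -> s t = s' t) ->
  (forall t : R, 0 < t -> s t ^+ 2 <= k t) ->
  mu.-integrable `[0, +oo[ (EFin \o k) -> L2 s.
Proof.
move=> cs' ss' sk ik; apply/L2E.
have ms := halfline_measurable_pos cs' ss'.
have ms2 : measurable_fun (`[0 : R, +oo[ : set R) (fun t => s t ^+ 2).
  exact: measurable_funX.
have ik' : mu.-integrable `]0, +oo[ (EFin \o k).
  apply: integrableS ik => // t /=; rewrite !in_itv/= !andbT; exact: ltW.
have : mu.-integrable `]0, +oo[ (EFin \o (fun t => s t ^+ 2)).
  apply: le_integrable ik' => //.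
    apply/measurable_EFinP; apply: measurable_funS ms2 => //.
    by move=> t /=; rewrite !in_itv/= !andbT => /ltW.
  move=> t /=; rewrite in_itv/= andbT => t0; rewrite lee_fin.
  by rewrite ger0_norm ?sqr_ge0// (le_trans (sk t t0))// ler_norm.
move=> /integrableP[_ fin]; apply/integrableP; split; first exact/measurable_EFinP.
rewrite -integral_itv_obnd_cbnd//.
apply: measurableT_comp => //; apply/measurable_EFinP.
exact/measurable_fun_itv_obnd_cbndP.
Qed.

Lemma continuous_bounded_on_balls (r : nat) (V : normedModType R)
  (h : 'cV[R]_r -> V) : continuous h ->
  forall rho : R, exists M, forall y, `|y| <= rho -> `|h y| <= M.
Proof.
move=> ch rho.
pose A := [set v : 'rV[R]_r | `|v^T| <= rho].
have ctr : continuous (fun v : 'rV[R]_r => v^T).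
  apply: continuous_mx => i j.
  have -> : (fun v : 'rV[R]_r => v^T i j) = fun v => v j i.
    by apply/funext => v; rewrite mxE.
  exact: coord_continuous.
have cA : compact A.
  apply: bounded_closed_compact.
    exists rho; split; first exact: num_real.
    move=> M rM v /= vrho; apply: mx_norm_lub => [|i j].
      by apply: le_trans (ltW rM); exact: le_trans vrho.
    have := mx_entry_norm v^T j i; rewrite mxE => /le_trans; apply.
    by apply: le_trans (ltW rM).
  have -> : A = (fun v : 'rV[R]_r => `|v^T|) @^-1` [set x | x <= rho] by [].
  apply: closed_comp; last exact: closed_le.
  move=> v _; apply: continuous_comp; first exact: ctr.
  exact: norm_continuous.
have : compact ((fun v : 'rV[R]_r => h v^T) @` A).
  apply: continuous_compact => //; apply: continuous_subspaceT => v.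
  by apply: (@continuous_comp _ _ _ (fun v : 'rV[R]_r => v^T)); [exact: ctr|exact: ch].
move=> /compact_bounded[M [_ MP]]; exists (M + 1) => y yrho.
apply: MP; first by rewrite ltrDl.
by exists y^T; rewrite ?trmxK//= /A/= trmxK.
Qed.

End Signals.

(** * The two stability arguments for scalar signals *)

Section StabilityCores.
Context {R : realType}.
Implicit Types (psi phi V v zd e : R -> R).
Local Notation mu := (@lebesgue_measure R).

(** Dissipation is used twice: with V as storage it makes e square-integrable;
    then zd and e are both admissible inputs for the potential of phi. *)
Lemma adaptive_L2_stability phi psi V v zd e (D c : R) :
  continuous phi -> (forall s, s != 0 -> 0 < phi s * s) ->
  prim0 phi s @[s --> +oo] --> +oo -> prim0 phi s @[s --> -oo] --> +oo ->
  0 < D -> 0 <= c ->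
  {within `[0, +oo[, continuous psi} -> {within `[0, +oo[, continuous V} ->
  {within `[0, +oo[, continuous zd} -> {within `[0, +oo[, continuous e} ->
  (forall t : R, 0 < t -> is_derive t 1 psi (- phi (psi t) + zd t - e t)) ->
  (forall t : R, 0 < t -> is_derive t 1 V (v t)) ->
  (forall t : R, 0 < t -> v t <= - (D * e t ^+ 2) + c * zd t ^+ 2) ->
  (forall t : R, 0 <= t -> 0 <= V t) -> L2 zd ->
  [/\ exists M, forall t : R, 0 <= t -> V t <= M,
    Linf psi, L2 (phi \o psi), L2 e & psi t @[t --> +oo] --> (0 : R)].
Proof.
move=> cphi sphi Fp Fm D0 c0 cpsi cV czd ce dpsi dV vle V0 /L2E izd.
have csq (s : R -> R) : {within `[0, +oo[, continuous s} ->
    {within `[0, +oo[, continuous (fun t => s t ^+ 2)}.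
  by move=> cs; apply: halfline_continuousM.
have cZ (k : R) (s : R -> R) : {within `[0, +oo[, continuous s} ->
    {within `[0, +oo[, continuous (fun t => k * s t)}.
  by move=> cs; apply: halfline_continuousM => //; apply: continuous_subspaceT;
     exact: cst_continuous.
have [iDe VM _] : [/\ mu.-integrable `[0, +oo[ (EFin \o (fun t => D * e t ^+ 2)),
    exists M, forall t : R, 0 <= t -> V t <= M &
    exists l : R, V t @[t --> +oo] --> l].
  apply: (@dissipation _ V v _ (fun t => c * zd t ^+ 2) 0) => //.
  - exact/cZ/csq.
  - exact/cZ/csq.
  - by move=> t _; rewrite mulr_ge0 ?sqr_ge0// ltW.
  - by move=> t _; rewrite mulr_ge0 ?sqr_ge0.
  - exact: (halfline_integrableZ c izd).
have ie : mu.-integrable `[0, +oo[ (EFin \o (fun t => e t ^+ 2)).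
  have := halfline_integrableZ (k := fun t => D * e t ^+ 2) D^-1 iDe; congr (_.-integrable _ _).
  by apply/funext => t /=; rewrite mulKf// gt_eqF.
have dF := prim0_is_derive cphi.
have cF : continuous (prim0 phi) by move=> x; apply: is_derive_continuous (dF x).
have cphipsi : {within `[0, +oo[, continuous (phi \o psi)}.
  exact: within_halfline_comp.
have [iphi [M FM] [L FL]] :
  [/\ mu.-integrable `[0, +oo[ (EFin \o (fun t => 2^-1 * phi (psi t) ^+ 2)),
    exists M, forall t : R, 0 <= t -> prim0 phi (psi t) <= M &
    exists l : R, prim0 phi (psi t) @[t --> +oo] --> l].
  apply: (@dissipation _ (prim0 phi \o psi)
    (fun t => phi (psi t) * (- phi (psi t) + zd t - e t)) _
    (fun t => 1 * zd t ^+ 2 + 1 * e t ^+ 2) 0) => //.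
  - exact: within_halfline_comp.
  - exact/cZ/csq.
  - by apply: halfline_continuousD; apply/cZ/csq.
  - by move=> t _; rewrite mulr_ge0 ?sqr_ge0// invr_ge0.
  - by move=> t _; rewrite !mul1r addr_ge0 ?sqr_ge0.
  - move=> t t0; have d1 := dpsi t t0; have d2 := dF (psi t).
    exact: is_derive1_comp.
  - move=> t t0.
    (* p a <= p^2 / 4 + a^2 for a = zd and a = - e *)
    have := sqr_ge0 (phi (psi t) - 2 * zd t); have := sqr_ge0 (phi (psi t) + 2 * e t).
    rewrite !sqrrD !sqrrN; nra.
  - by move=> t _; exact: prim0_ge0.
  - exact: halfline_integrable_lincomb.
have [B BP] := coercive_bounded M Fp Fm.
have psiB (t : R) : 0 <= t -> `|psi t| <= B by move=> t0; apply/BP/FM.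
have iphi2 : mu.-integrable `[0, +oo[ (EFin \o (fun t => phi (psi t) ^+ 2)).
  have := halfline_integrableZ (k := fun t => 2^-1 * phi (psi t) ^+ 2) 2 iphi; congr (_.-integrable _ _).
  by apply/funext => t /=; rewrite mulVKf// gt_eqF.
split=> //; first by apply/LinfP; exists B.
- exact/L2E.
- exact/L2E.
have phi0 (v' : R) : v' != 0 -> 0 < phi v' ^+ 2.
  move=> /sphi; rewrite exprn_even_gt0//=.
  by apply: contraTneq => ->; rewrite mul0r ltxx.
apply: (@potential_limit_cvg0 _ (prim0 phi) (fun x => phi x ^+ 2) psi B L) => //.
- exact: prim00.
- exact: prim0_gt0.
- by move=> x; apply: cvgM; exact: cphi.
- by move=> x; exact: sqr_ge0.
Qed.

(** In W = V + b psi^2 the weight b is chosen so that the cross term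
    2 b |psi| |e|, once split by Young's inequality, costs exactly the dissipation
    D e^2 available in V'. *)
Lemma adaptive_leaky_boundedness phi psi V v zd e (D c l C K Z : R) :
  (forall s, s != 0 -> 0 < phi s * s) ->
  0 < K -> (forall s, K * `|s| <= `|phi s|) ->
  0 < D -> 0 <= c -> 0 < l ->
  {within `[0, +oo[, continuous psi} -> {within `[0, +oo[, continuous V} ->
  (forall t : R, 0 < t -> is_derive t 1 psi (- phi (psi t) + zd t - e t)) ->
  (forall t : R, 0 < t -> is_derive t 1 V (v t)) ->
  (forall t : R, 0 < t ->
     v t <= - (D * e t ^+ 2) + c * zd t ^+ 2 - l * V t + C) ->
  (forall t : R, 0 <= t -> 0 <= V t) ->
  (forall t : R, 0 <= t -> `|zd t| <= Z) ->
  Linf psi /\ exists M, forall t : R, 0 <= t -> V t <= M.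
Proof.
move=> sphi K0 Kphi D0 c0 l0 cpsi cV dpsi dV vle V0 zdZ.
have phis s : K * s ^+ 2 <= phi s * s.
  have [->|s0] := eqVneq s 0; first by rewrite expr0n !mulr0.
  have -> : phi s * s = `|phi s| * `|s| by rewrite -normrM gtr0_norm ?sphi.
  by rewrite -[s ^+ 2]real_normK ?num_real// expr2 mulrA ler_wpM2r.
pose b := K * D / 2.
have b0 : 0 < b by rewrite divr_gt0// mulr_gt0.
pose W t := V t + b * psi t ^+ 2.
have cW : {within `[0, +oo[, continuous W}.
  apply: halfline_continuousD => //; apply: halfline_continuousM.
    by apply: continuous_subspaceT; exact: cst_continuous.
  exact: halfline_continuousM.
pose dp t := - phi (psi t) + zd t - e t.
have dW (t : R) : 0 < t -> is_derive t 1 W (v t + b * (2 * psi t * dp t)).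
  move=> t0; have d1 := dV t t0; have d2 := dpsi t t0.
  have -> : W = V + b *: (psi * psi).
    by apply/funext => s; rewrite /W expr2.
  apply: is_derive_eq (is_deriveD d1 (is_deriveZ b (is_deriveM d2 d2))) _.
  by rewrite /GRing.scale/= /dp; ring.
have [M WM] : exists M, forall t : R, 0 <= t -> W t <= M.
  apply: (@linear_differential_inequality _ W _ (Num.min l K)
    ((c + D) * Z ^+ 2 + C) _ cW dW); first by rewrite lt_min l0.
  move=> t t0.
  have zd2 : zd t ^+ 2 <= Z ^+ 2.
    have Z0 : 0 <= Z by exact: le_trans (normr_ge0 _) (zdZ 0 (lexx 0)).
    rewrite -[zd t ^+ 2]real_normK ?num_real// lerXn2r ?nnegrE//.
    by apply: zdZ; exact: ltW.
  have psi_le : b * (2 * psi t * dp t) <=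
      - (b * K * psi t ^+ 2) + D * (zd t ^+ 2 + e t ^+ 2).
    have h1 : b * (phi (psi t) * psi t) >= b * (K * psi t ^+ 2).
      by rewrite ler_pM2l// phis.
    have h2 : 0 <= b * K * (psi t - 2 / K * zd t) ^+ 2 + b * K * (psi t + 2 / K * e t) ^+ 2.
      by rewrite addr_ge0// mulr_ge0 ?sqr_ge0// ltW// mulr_gt0.
    have h3 : b * K * (psi t - 2 / K * zd t) ^+ 2 + b * K * (psi t + 2 / K * e t) ^+ 2
      = 2 * (b * K * psi t ^+ 2) - 2 * (b * (2 * psi t * (zd t - e t)))
        + 2 * (D * (zd t ^+ 2 + e t ^+ 2)).
      by rewrite /b; field; rewrite gt_eqF.
    have -> : b * (2 * psi t * dp t) = - 2 * (b * (phi (psi t) * psi t))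
       + b * (2 * psi t * (zd t - e t)) by rewrite /dp; ring.
    lra.
  have hmin : Num.min l K * W t <= l * V t + b * K * psi t ^+ 2.
    rewrite /W mulrDr lerD//.
      by apply: ler_wpM2r; [exact/V0/ltW|rewrite ge_min lexx].
    have -> : b * K * psi t ^+ 2 = K * (b * psi t ^+ 2) by ring.
    apply: ler_wpM2r; first by rewrite mulr_ge0 ?sqr_ge0// ltW.
    by rewrite ge_min lexx orbT.
  have hz : (c + D) * zd t ^+ 2 <= (c + D) * Z ^+ 2.
    by rewrite ler_wpM2l// addr_ge0// ltW.
  have := vle t t0; rewrite mulNr; lra.
split; last first.
  exists M => t t0; apply: le_trans (WM t t0); rewrite lerDl.
  by rewrite mulr_ge0 ?sqr_ge0// ltW.
apply/LinfP; exists (Num.sqrt (M / b)) => t t0.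
rewrite -sqrtr_sqr ler_sqrt; last first.
  rewrite divr_ge0// ?(ltW b0)//; apply: le_trans (WM t t0).
  by rewrite addr_ge0 ?V0// mulr_ge0 ?sqr_ge0// ltW.
rewrite ler_pdivlMr// mulrC; apply: le_trans (WM t t0).
by rewrite lerDr V0.
Qed.

End StabilityCores.

(** * The closed loop *)

(** The terms of the derivative of the proportional part (first two lines) that
    do not involve theta cancel against the right-hand side of the integral part;
    what remains is the direction A3, P3 in which the motion is unknown. *)
Lemma estimate_cancellation (R : realType) (d : nat) (p ph dz u : R)
  (al At A1 A2 A3 Pt P1 P2 P3 lt : 'cV[R]_d) :
  (- ph + dz) *: al + p *: (A1 + u *: A2 + A3 + At)
    - (P1 + u *: P2 + P3 + Pt)
    + (ph *: al + Pt - p *: At - (p *: A1 - P1) - u *: (p *: A2 - P2) - lt)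
  = dz *: al + (p *: A3 - P3) - lt.
Proof. by apply/matrixP => i j; rewrite !mxE; ring. Qed.

Lemma leakage_expand (R : realType) (d : nat) (l : R) (a q th ths : 'cV[R]_d) :
  2 * dotv (a + q - l *: th) (th - ths) =
  2 * dotv a (th - ths) + 2 * dotv (q - l *: ths) (th - ths)
  - 2 * (l * dotv (th - ths) (th - ths)).
Proof. by rewrite !dotvBl !dotvDl !dotvZl; ring. Qed.

Section StateBlocks.
Context {R : realType} {m m1 m2 : nat}.
Local Notation N := (m + (m1 + m2))%N.

Lemma tildeD (x x' : 'cV[R]_N) (y y' : 'cV[R]_m2) :
  tilde (x + x') (y + y') = tilde x y + tilde x' y'.
Proof. by rewrite /tilde /blk1 /blk2' !linearD/= !add_col_mx. Qed.

Lemma tildeZ (a : R) (x : 'cV[R]_N) (y : 'cV[R]_m2) :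
  tilde (a *: x) (a *: y) = a *: tilde x y.
Proof. by rewrite /tilde /blk1 /blk2' !linearZ/= !scale_col_mx. Qed.

Lemma tilde_split (x : 'cV[R]_N) (y : 'cV[R]_m2) :
  tilde x y = tilde x 0 + tilde 0 y.
Proof. by rewrite -tildeD addr0 add0r. Qed.

Lemma tilde_linearl : linear (fun x : 'cV[R]_N => tilde x (0 : 'cV[R]_m2)).
Proof. by move=> a x x'; rewrite -tildeZ -tildeD scaler0 addr0. Qed.

Lemma tilde_linearr : linear (fun y : 'cV[R]_m2 => tilde (0 : 'cV[R]_N) y).
Proof. by move=> a y y'; rewrite -tildeZ -tildeD scaler0 addr0. Qed.

Lemma is_derive_tilde (x : R -> 'cV[R]_N) (y : R -> 'cV[R]_m2)
  (x' : 'cV[R]_N) (y' : 'cV[R]_m2) (t : R) :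
  is_derive t 1 x x' -> is_derive t 1 y y' ->
  is_derive t 1 (fun s => tilde (x s) (y s)) (tilde x' y').
Proof.
move=> dx dy.
have -> : (fun s => tilde (x s) (y s)) =
  (fun s => tilde (x s) (0 : 'cV[R]_m2)) + (fun s => tilde (0 : 'cV[R]_N) (y s)).
  by apply/funext => s; rewrite tilde_split.
rewrite tilde_split; apply: is_deriveD.
  exact: is_derive_linear tilde_linearl dx.
exact: is_derive_linear tilde_linearr dy.
Qed.

Lemma continuous_tilde (T : topologicalType) (x : T -> 'cV[R]_N)
  (y : T -> 'cV[R]_m2) : continuous x -> continuous y ->
  continuous (fun s => tilde (x s) (y s)).
Proof.
move=> cx cy.
have -> : (fun s => tilde (x s) (y s)) =
  (fun s => tilde (x s) (0 : 'cV[R]_m2) + tilde (0 : 'cV[R]_N) (y s)).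
  by apply/funext => s; rewrite tilde_split.
move=> s; apply: cvgD.
  apply: (@continuous_comp _ _ _ x (fun z => tilde z (0 : 'cV[R]_m2))).
    exact: cx.
  exact: linear_mx_continuous tilde_linearl _.
apply: (@continuous_comp _ _ _ y (fun z => tilde (0 : 'cV[R]_N) z)).
  exact: cy.
exact: linear_mx_continuous tilde_linearr _.
Qed.

Lemma tilde_norm_bounded (rx ry : R) : exists M, forall (x : 'cV[R]_N) y,
  `|x| <= rx -> `|y| <= ry -> `|tilde x (y : 'cV[R]_m2)| <= M.
Proof.
have [Mx MxP] := continuous_bounded_on_balls (linear_mx_continuous tilde_linearl) rx.
have [My MyP] := continuous_bounded_on_balls (linear_mx_continuous tilde_linearr) ry.
exists (Mx + My) => x y xr yr; rewrite tilde_split.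
by apply: le_trans (ler_normD _ _) _; rewrite lerD ?MxP ?MyP.
Qed.

(** The velocity of the reconstructed state: its third block follows the auxiliary
    system, so the unknown nu'' never enters and nu' enters through one direction
    only. *)
Lemma tilde_plant_rhs (d r : nat) (f g : 'cV[R]_N -> 'cV[R]_N)
  (nu : 'cV[R]_N -> 'cV[R]_d -> 'cV[R]_(m1 + m2))
  (fxi : 'cV[R]_N -> 'cV[R]_r -> R -> 'cV[R]_r) (hxi : 'cV[R]_r -> 'cV[R]_m2)
  (theta : 'cV[R]_d) x xi (t u : R) :
  tilde (plant_rhs f g nu theta x u) ('d hxi xi (fxi x xi t)) =
  ftilde f fxi hxi x xi t + u *: gtilde g x + dir2' m m2 (usubmx (nu x theta)).
Proof.
rewrite /tilde /ftilde /gtilde /dir2' /plant_rhs /vartheta /blk1 /blk2'.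
rewrite !linearD !linearZ/= !col_mxKu !col_mxKd.
rewrite !scale_col_mx !add_col_mx !linear0 !addr0.
by congr (col_mx _ (col_mx _ _)); rewrite addrAC.
Qed.

End StateBlocks.

Section ClosedLoop.
Context {R : realType} {m m1 m2 d r : nat}.
Local Notation N := (m + (m1 + m2))%N.
Context {f g : 'cV[R]_N -> 'cV[R]_N}
  {nu : 'cV[R]_N -> 'cV[R]_d -> 'cV[R]_(m1 + m2)}
  {psi : 'cV[R]_N -> R -> R} {phi : R -> R}
  {alpha Psi : 'cV[R]_N -> R -> 'cV[R]_d}
  {fxi : 'cV[R]_N -> 'cV[R]_r -> R -> 'cV[R]_r} {hxi : 'cV[R]_r -> 'cV[R]_m2}.
Hypothesis nu_C1 : C1 (fun p : 'cV[R]_N * 'cV[R]_d => nu p.1 p.2).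
Hypothesis psi_C1 : C1 (fun p : 'cV[R]_N * R => psi p.1 p.2).
Hypothesis alpha_C1 : C1 (fun p : 'cV[R]_N * R => alpha p.1 p.2).
Hypothesis Psi_C1 : C1 (fun p : 'cV[R]_N * R => Psi p.1 p.2).
Hypothesis hxi_C1 : C1 hxi.
Hypothesis Lg_neq0 : forall x (t : R), 0 < t -> Dx psi x t (g x) != 0.

Lemma Dx_plant_rhs theta x (u t : R) :
  Dx psi x t (plant_rhs f g nu theta x u) =
  Dx psi x t (f x) + zfun nu psi x theta t + u * Dx psi x t (g x).
Proof. by rewrite /plant_rhs !DxD DxZ. Qed.

(** With xt = x this is the computation behind the matching condition; with the
    reconstructed state it gives the closed-loop equation of psi. *)
Lemma control_cancels theta x xt th (t : R) : 0 < t ->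
  Dx psi x t (plant_rhs f g nu theta x (control_at f g nu psi phi x xt th t))
    + Dt psi x t + phi (psi x t) = zfun nu psi x theta t - zfun nu psi xt th t.
Proof.
move=> t0; rewrite Dx_plant_rhs /control_at [_^-1 * _]mulrC mulfVK ?Lg_neq0//.
by ring.
Qed.

Section Trajectory.
Context {Gam : 'M[R]_d} {lam : R} {theta : 'cV[R]_d}
  {x : R -> 'cV[R]_N} {xi : R -> 'cV[R]_r} {thI : R -> 'cV[R]_d}.
Hypothesis cl :
  closed_loop f g nu psi phi alpha Psi fxi hxi Gam lam theta x xi thI.

Let xt (t : R) := tilde (x t) (hxi (xi t)).
Let th (t : R) := theta_hat psi alpha Psi hxi Gam (x t) (xi t) (thI t) t.
Let w (t : R) := thetaP psi alpha Psi (x t) (xt t) t + thI t.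
Let z x th (t : R) := zfun nu psi x th t.

Lemma psi_is_derive (t : R) : 0 < t ->
  is_derive t 1 (fun s => psi (x s) s)
    (- phi (psi (x t) t) + (z (x t) theta t - z (xt t) (th t) t)).
Proof.
move=> t0; have [[_ dx] _ _] := cl.
apply: is_derive_eq (is_derive_along psi_C1 (dx t t0)) _.
have := control_cancels theta (x t) (xt t) (th t) t0.
by rewrite /z => <-; rewrite [RHS]addrC addrK.
Qed.

Lemma estimate_is_derive (t : R) : 0 < t -> is_derive t 1 w
  ((z (x t) theta t - z (xt t) (th t) t) *: alpha (xt t) t
   + (psi (x t) t *: Dx alpha (xt t) t (dir2' m m2 (usubmx (nu (x t) theta)))
      - Dx Psi (xt t) t (dir2' m m2 (usubmx (nu (x t) theta))))
   - lam *: th t).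
Proof.
move=> t0; have [[_ dx] [_ dxi] [_ dthI]] := cl.
have dh : is_derive t 1 (hxi \o xi) ('d hxi (xi t) (fxi (x t) (xi t) t)).
  by apply: is_derive_comp_diff (dxi t t0); case: hxi_C1.
have dxt : is_derive t 1 xt _ := is_derive_tilde (dx t t0) dh.
have dal := is_derive_along alpha_C1 dxt.
have dPsi := is_derive_along Psi_C1 dxt.
have dpsi := psi_is_derive t0.
have dP := is_deriveD (is_deriveB (is_derive_scale dpsi dal) dPsi) (dthI t t0).
apply: is_derive_eq dP _.
rewrite tilde_plant_rhs /thetaI_rhs -/(xt t) -/(th t).
rewrite !(DxD, DxZ).
exact: estimate_cancellation.
Qed.

Lemma trajectory_continuous :
  [/\ {within `[0, +oo[, continuous (fun t => psi (x t) t)},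
    {within `[0, +oo[, continuous w},
    {within `[0, +oo[, continuous (fun t => z (x t) theta t)},
    (forall p, {within `[0, +oo[, continuous (fun t => z (xt t) p t)}) &
    {within `[0, +oo[, continuous (fun t => z (xt t) (th t) t)}].
Proof.
have [[cx _] [cxi _] [cthI _]] := cl.
have cid : {within `[0 : R, +oo[, continuous id}.
  by apply: continuous_subspaceT => t; exact: cvg_id.
have cxt : {within `[0, +oo[, continuous xt}.
  apply: continuous_tilde => //; apply: within_halfline_comp cxi.
  exact: C1_continuous.
have calong (U V : normedModType R) (F : U -> R -> V) (y : R -> U) :
    C1 (fun p : U * R => F p.1 p.2) -> {within `[0, +oo[, continuous y} ->
    {within `[0, +oo[, continuous (fun t => F (y t) t)}.
  move=> CF cy.
  exact: within_halfline_comp (C1_continuous CF) (halfline_pair cy cid).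
have cpsi := calong _ _ _ _ psi_C1 cx.
have cw : {within `[0, +oo[, continuous w}.
  have cal := calong _ _ _ _ alpha_C1 cxt.
  have cPsi := calong _ _ _ _ Psi_C1 cxt.
  have csc := continuous_scale cpsi cal.
  move=> t; apply: cvgD; last exact: cthI.
  by apply: cvgB; [exact: csc|exact: cPsi].
have cth : {within `[0, +oo[, continuous th}.
  apply: (@within_halfline_comp _ _ _ w (mulmx Gam)) => //.
  by apply: linear_mx_continuous => a u v; rewrite linearP.
have cz (y : R -> 'cV[R]_N) (p : R -> 'cV[R]_d) :
    {within `[0, +oo[, continuous y} -> {within `[0, +oo[, continuous p} ->
    {within `[0, +oo[, continuous (fun t => z (y t) (p t) t)}.
  move=> cy cp; apply: (continuous_Dx psi_C1 cy cid).
  have clin : linear (fun v => col_mx (0 : 'cV[R]_m) (v : 'cV[R]_(m1 + m2))).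
    by move=> a u v; rewrite scale_col_mx add_col_mx scaler0 addr0.
  apply: (@within_halfline_comp _ _ _ (fun t => nu (y t) (p t))).
    exact: linear_mx_continuous clin.
  exact: within_halfline_comp (C1_continuous nu_C1) (halfline_pair cy cp).
have ccst p : {within `[0 : R, +oo[, continuous (fun=> p : 'cV[R]_d)}.
  by apply: continuous_subspaceT; exact: cst_continuous.
by split=> // [|p|]; apply: cz.
Qed.

Context {ths : 'cV[R]_d} {D D1 : R}.
Hypothesis Gam_pos : sym_posdef Gam.
Hypotheses (D_gt0 : 0 < D) (D1_gt0 : 0 < D1).
Hypothesis z_match : forall y (t : R), 0 < t -> z y theta t = z y ths t.
Hypothesis z_sign : forall y p (t : R), 0 < t -> z y p t != z y ths t ->
  0 < (z y p t - z y ths t) * dotv (alpha y t) (p - ths).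
Hypothesis z_ubound : forall y p (t : R), 0 < t ->
  `|z y p t - z y ths t| <= D * `|dotv (alpha y t) (p - ths)|.
Hypothesis z_lbound : forall y p (t : R), 0 < t ->
  D1 * `|dotv (alpha y t) (p - ths)| <= `|z y p t - z y ths t|.

Let zd (t : R) := z (x t) theta t - z (xt t) theta t.
Let e (t : R) := z (xt t) (th t) t - z (xt t) ths t.
(* V is written in dw = Gam^-1 (th - ths), so that only w is differentiated. *)
Let dw (t : R) : 'cV[R]_d := w t - invmx Gam *m ths.
Let V (t : R) := dotv (dw t) (Gam *m dw t).

Lemma scaled_estimate_error (t : R) : Gam *m dw t = th t - ths.
Proof. by rewrite /dw mulmxBr mulKVmx// posdef_unit. Qed.

Lemma lyapunov_is_derive (t : R) (w' : 'cV[R]_d) : is_derive t 1 w w' ->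
  is_derive t 1 V (2 * dotv w' (th t - ths)).
Proof.
move=> w_der; have ddw : is_derive t 1 dw w'.
  by rewrite -[w']subr0; apply: is_deriveB.
have dGdw : is_derive t 1 (fun s => Gam *m dw s) (Gam *m w').
  apply: (@is_derive_linear _ _ _ _ (mulmx Gam)) ddw.
  by move=> a u v; rewrite linearP.
apply: is_derive_eq (is_derive_dotv ddw dGdw) _.
by rewrite [X in _ + X]dotv_mulmx Gam_pos.1 [X in _ + X]dotvC
  scaled_estimate_error -mulr2n mulr_natl.
Qed.

Lemma residual_split (t : R) : 0 < t ->
  z (x t) theta t - z (xt t) (th t) t = zd t - e t.
Proof. by move=> t0; rewrite /zd /e (z_match (xt t) t0); ring. Qed.

(** The only place where the monotonicity of z in the parameter along alpha and
    the two-sided comparison with alpha^T (th - ths) enter. *)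
Lemma lyapunov_rate (t : R) : 0 < t ->
  2 * dotv ((zd t - e t) *: alpha (xt t) t) (th t - ths) <=
  - (D^-1 * e t ^+ 2) + D / D1 ^+ 2 * zd t ^+ 2.
Proof.
move=> t0; rewrite dotvZl; apply: sector_cross_term => //.
- have [/eqP|ne] := eqVneq (z (xt t) (th t) t) (z (xt t) ths t).
    by rewrite -subr_eq0 /e => /eqP ->; rewrite mul0r.
  by rewrite ltW// z_sign.
- exact: z_ubound.
- exact: z_lbound.
Qed.

Lemma psi_error_is_derive (t : R) : 0 < t ->
  is_derive t 1 (fun s => psi (x s) s) (- phi (psi (x t) t) + zd t - e t).
Proof. by move=> t0; rewrite -addrA -residual_split//; exact: psi_is_derive. Qed.

Lemma lyapunov_continuous : {within `[0, +oo[, continuous V}.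
Proof.
have [_ cw _ _ _] := trajectory_continuous.
have cdw : {within `[0, +oo[, continuous dw}.
  by move=> t; apply: cvgB; [exact: cw|exact: cvg_cst].
have -> : V = fun t => \sum_i dw t i 0 * (Gam *m dw t) i 0.
  by apply/funext => t; rewrite /V dotvE.
have cGdw : {within `[0, +oo[, continuous (fun t => Gam *m dw t)}.
  apply: (@within_halfline_comp _ _ _ dw (mulmx Gam)) => //.
  by apply: linear_mx_continuous => a u v; rewrite linearP.
apply: (@continuous_sum R (subspace `[0 : R, +oo[) R^o) => i.
apply: halfline_continuousM; first exact: (continuous_entry cdw).
exact: (continuous_entry cGdw).
Qed.

Lemma mismatch_continuous : {within `[0, +oo[, continuous zd} /\
  {within `[0, +oo[, continuous e}.
Proof.
have [_ _ cz1 cz2 cz3] := trajectory_continuous.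
by split; apply: halfline_continuousB.
Qed.

Lemma lyapunov_ge0 (t : R) : 0 <= V t.
Proof. exact: posdef_ge0. Qed.

Lemma lyapunov_bounds_estimate : (exists M, forall t : R, 0 <= t -> V t <= M) ->
  Linf th.
Proof.
move=> [M VM]; have [C C0 CP] := posdef_norm_le Gam_pos.
apply/LinfP; exists (Num.sqrt (C * M) + `|ths|) => t t0.
rewrite -[th t](subrK ths); apply: le_trans (ler_normD _ _) _.
rewrite lerD2r -scaled_estimate_error.
have le_CM : `|Gam *m dw t| ^+ 2 <= C * M.
  by apply: le_trans (CP _) _; rewrite ler_pM2l//; exact: VM.
by rewrite -[leLHS]ger0_norm// -sqrtr_sqr ler_sqrt// (le_trans _ le_CM)// sqr_ge0.
Qed.

Lemma L2_estimate_stability :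
  continuous phi -> (forall s, s != 0 -> 0 < phi s * s) ->
  prim0 phi s @[s --> +oo] --> +oo -> prim0 phi s @[s --> -oo] --> +oo ->
  lam = 0 ->
  (forall t : R, 0 < t ->
     psi (x t) t *: Dx alpha (xt t) t (dir2' m m2 (usubmx (nu (x t) theta)))
     - Dx Psi (xt t) t (dir2' m m2 (usubmx (nu (x t) theta))) = 0) ->
  L2 zd ->
  [/\ Linf th, Linf (fun t => psi (x t) t), L2 (fun t => phi (psi (x t) t)),
    L2 e & psi (x t) t @[t --> +oo] --> (0 : R)].
Proof.
move=> cphi sphi Fp Fm lam0 dir0 zd2.
have [cpsi _ _ _ _] := trajectory_continuous.
have [czd ce] := mismatch_continuous.
have Dinv : 0 < D^-1 by rewrite invr_gt0.
have c0 : 0 <= D / D1 ^+ 2 by rewrite divr_ge0 ?sqr_ge0// ltW.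
have dV (t : R) : 0 < t ->
    is_derive t 1 V (2 * dotv ((zd t - e t) *: alpha (xt t) t) (th t - ths)).
  move=> t0; apply: lyapunov_is_derive.
  apply: is_derive_eq (estimate_is_derive t0) _.
  by rewrite dir0// lam0 scale0r addr0 subr0 residual_split.
have [VM psiM phi2 e2 psi0] := adaptive_L2_stability cphi sphi Fp Fm Dinv c0 cpsi
  lyapunov_continuous czd ce psi_error_is_derive dV lyapunov_rate
  (fun t _ => lyapunov_ge0 t) zd2.
by split=> //; exact: lyapunov_bounds_estimate.
Qed.

(** The leakage contributes - 2 lam |eta|^2 - 2 lam ths^T eta for eta = th - ths;
    half of the first term absorbs, by Young's inequality, everything linear in
    eta, and the other half dominates V. *)
Lemma leaky_estimate_boundedness (K Q Z : R) :
  (forall s, s != 0 -> 0 < phi s * s) ->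
  0 < K -> (forall s, K * `|s| <= `|phi s|) -> 0 < lam ->
  (forall t : R, 0 < t ->
     `|psi (x t) t *: Dx alpha (xt t) t (dir2' m m2 (usubmx (nu (x t) theta)))
     - Dx Psi (xt t) t (dir2' m m2 (usubmx (nu (x t) theta)))| <= Q) ->
  (forall t : R, 0 <= t -> `|zd t| <= Z) ->
  Linf th /\ Linf (fun t => psi (x t) t).
Proof.
move=> sphi K0 Kphi lam0 dirQ zdZ.
have [cpsi _ _ _ _] := trajectory_continuous.
have [C C0 CP] := posdef_le_dotv Gam_pos.
pose q (t : R) :=
  psi (x t) t *: Dx alpha (xt t) t (dir2' m m2 (usubmx (nu (x t) theta)))
     - Dx Psi (xt t) t (dir2' m m2 (usubmx (nu (x t) theta))).
pose B := d%:R * (Q + lam * `|ths|).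
have Dinv : 0 < D^-1 by rewrite invr_gt0.
have c0 : 0 <= D / D1 ^+ 2 by rewrite divr_ge0 ?sqr_ge0// ltW.
have l0 : 0 < lam / C by rewrite divr_gt0.
have dV (t : R) : 0 < t -> is_derive t 1 V
    (2 * dotv ((zd t - e t) *: alpha (xt t) t + q t - lam *: th t) (th t - ths)).
  move=> t0; apply: lyapunov_is_derive.
  apply: is_derive_eq (estimate_is_derive t0) _.
  by rewrite residual_split.
suff rateV (t : R) : 0 < t ->
    2 * dotv ((zd t - e t) *: alpha (xt t) t + q t - lam *: th t) (th t - ths) <=
    - (D^-1 * e t ^+ 2) + D / D1 ^+ 2 * zd t ^+ 2 - lam / C * V t + B ^+ 2 / lam.
  have [psiM VM] := adaptive_leaky_boundedness sphi K0 Kphi Dinv c0 l0 cpsi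
    lyapunov_continuous psi_error_is_derive dV rateV (fun t _ => lyapunov_ge0 t) zdZ.
  by split=> //; exact: lyapunov_bounds_estimate.
move=> t0; set eta := th t - ths.
have VC : lam / C * V t <= lam * dotv eta eta.
  rewrite -mulrA ler_pM2l// mulrC ler_pdivrMr// mulrC.
  by rewrite /eta -scaled_estimate_error; exact: CP.
have qB : dotv (q t - lam *: ths) eta <= B * `|eta|.
  apply: le_trans (ler_norm _) _; apply: le_trans (dotv_le_norm _ _) _.
  rewrite /B -mulrA ler_wpM2l// ler_wpM2r//.
  apply: le_trans (ler_normB _ _) _; rewrite lerD ?dirQ//.
  by rewrite normrZ gtr0_norm.
have young : 2 * (B * `|eta|) <= lam * `|eta| ^+ 2 + B ^+ 2 / lam.
  have : 0 <= lam * (`|eta| - B / lam) ^+ 2 by rewrite mulr_ge0 ?sqr_ge0// ltW.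
  have -> : lam * (`|eta| - B / lam) ^+ 2 =
    lam * `|eta| ^+ 2 - 2 * (B * `|eta|) + B ^+ 2 / lam.
    by field; rewrite gt_eqF.
  lra.
have eta2 : lam * `|eta| ^+ 2 <= lam * dotv eta eta.
  by rewrite ler_pM2l// sqr_norm_le_dotv.
have rate := lyapunov_rate t0; rewrite -/eta in rate.
rewrite (leakage_expand lam) -/eta.
lra.
Qed.

End Trajectory.

End ClosedLoop.

Theorem theorem3 (R : realType) (m m1 m2 d r : nat)
  (f g : 'cV[R]_(m + (m1 + m2)) -> 'cV[R]_(m + (m1 + m2)))
  (nu : 'cV[R]_(m + (m1 + m2)) -> 'cV[R]_d -> 'cV[R]_(m1 + m2))
  (Om Omhat : set 'cV[R]_d)
  (psi : 'cV[R]_(m + (m1 + m2)) -> R -> R)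
  (phi : R -> R)
  (alpha Psi : 'cV[R]_(m + (m1 + m2)) -> R -> 'cV[R]_d)
  (fxi : 'cV[R]_(m + (m1 + m2)) -> 'cV[R]_r -> R -> 'cV[R]_r)
  (hxi : 'cV[R]_r -> 'cV[R]_m2)
  (* regularity and standing conventions *)
  (f_C1 : C1 f) (g_C1 : C1 g)
  (nu_C1 : C1 (fun p : 'cV[R]_(m + (m1 + m2)) * 'cV[R]_d => nu p.1 p.2))
  (psi_C1 : C1 (fun p : 'cV[R]_(m + (m1 + m2)) * R => psi p.1 p.2))
  (alpha_C1 : C1 (fun p : 'cV[R]_(m + (m1 + m2)) * R => alpha p.1 p.2))
  (alpha_bnd : bounded_in_t alpha)
  (control_bnd : bounded_in_t
     (fun p : 'cV[R]_(m + (m1 + m2)) * 'cV[R]_m2 * 'cV[R]_d =>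
        control f g nu psi phi p.1.1 p.1.2 p.2))
  (A1 : forall delta : R, 0 < delta -> exists eps : R, 0 <= eps /\
     forall theta u x, Om theta -> plant_sol f g nu theta u x ->
     forall t, 0 <= t -> `|psi (x t) t| <= delta -> `|x t| <= eps)
  (A2 : exists delta1 : R, 0 < delta1 /\
     forall x t, 0 < t -> delta1 < `|Dx psi x t (g x)|)
  (A3 : forall theta, Om theta -> exists ths, Omhat ths /\
     forall x t, 0 <= t ->
       let us := control_at f g nu psi phi x x ths t in
       Dx psi x t (plant_rhs f g nu theta x us) + Dt psi x t
         + phi (psi x t) = 0)
  (A4_cont : continuous phi)
  (A4_sign : forall s, s != 0 -> 0 < phi s * s)
  (A4_pinfty : prim0 phi s @[s --> +oo] --> +oo)
  (A4_ninfty : prim0 phi s @[s --> -oo] --> +oo)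
  (A5_sign : forall ths, Omhat ths -> forall x th t, 0 <= t ->
     zfun nu psi x th t != zfun nu psi x ths t ->
     0 < (zfun nu psi x th t - zfun nu psi x ths t)
           * dotv (alpha x t) (th - ths))
  (A5_bound : exists D : R, 0 < D /\
     forall ths, Omhat ths -> forall x th t, 0 <= t ->
     `|zfun nu psi x th t - zfun nu psi x ths t|
       <= D * `|dotv (alpha x t) (th - ths)|)
  (A6 : exists D1 : R, 0 < D1 /\
     forall ths, Omhat ths -> forall x th t, 0 < t ->
     D1 * `|dotv (alpha x t) (th - ths)|
       <= `|zfun nu psi x th t - zfun nu psi x ths t|)
  (A7_fxi : C1_on [set p : 'cV[R]_(m + (m1 + m2)) * 'cV[R]_r * R | 0 <= p.2]
     (fun p => fxi p.1.1 p.1.2 p.2))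
  (A7_hxi : C1 hxi)
  (A7_Psi : C1 (fun p : 'cV[R]_(m + (m1 + m2)) * R => Psi p.1 p.2))
  (A7_sol : forall theta u x xi, Om theta ->
     plant_sol f g nu theta u x -> xi_sol fxi x xi ->
     (forall t, 0 <= t -> forall v : 'cV[R]_m1,
        let xt := tilde (x t) (hxi (xi t)) in
        Dx Psi xt t (dir2' m m2 v) = psi xt t *: Dx alpha xt t (dir2' m m2 v))
     /\ (Linf x -> Linf xi))
  (Gam : 'M[R]_d) (Gam_pos : sym_posdef Gam) :
  (* P8 *)
  (forall lam : R, 0 < lam -> sector phi ->
   forall theta x xi thI, Om theta ->
   closed_loop f g nu psi phi alpha Psi fxi hxi Gam lam theta x xi thI ->
   let xt t := tilde (x t) (hxi (xi t)) in
   Linf (fun t => zfun nu psi (x t) theta t - zfun nu psi (xt t) theta t) ->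
   Linf (fun t => (psi (x t) t - psi (xt t) t)
           *: Dx alpha (xt t) t (dir2' m m2 (usubmx (nu (x t) theta)))) ->
   [/\ Linf (fun t => psi (x t) t), Linf x, Linf xi &
       Linf (fun t => theta_hat psi alpha Psi hxi Gam (x t) (xi t) (thI t) t)])
  /\
  (* P9 *)
  (forall (Psi9 : 'cV[R]_(m + (m1 + m2)) -> R -> 'cV[R]_d) theta x xi thI,
   let xt t := tilde (x t) (hxi (xi t)) in
   let th t := theta_hat psi alpha Psi9 hxi Gam (x t) (xi t) (thI t) t in
   let dpsi := derive1 (fun t => psi (x t) t) in
   let zdiff t := zfun nu psi (x t) theta t - zfun nu psi (xt t) theta t in
   let zerr t := zfun nu psi (xt t) theta t - zfun nu psi (xt t) (th t) t in
   Om theta ->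
   closed_loop f g nu psi phi alpha Psi9 fxi hxi Gam 0 theta x xi thI ->
   (Psi9 = (fun _ _ => 0) /\
      (forall t, 0 <= t -> forall v, Dx alpha (xt t) t (dir2' m m2 v) = 0))
   \/ (Psi9 = Psi /\ (forall t, 0 <= t -> psi (x t) t = psi (xt t) t)) ->
   L2 zdiff ->
   [/\ Linf (fun t => psi (x t) t),
       L2 (fun t => phi (psi (x t) t))
         /\ (sector phi -> L2 (fun t => psi (x t) t)),
       L2 dpsi, L2 zerr & Linf x /\ Linf xi]
   /\
   (bounded_in_t (gradx psi) -> bounded_in_t (Dt psi) -> Linf zdiff ->
    [/\ Linf dpsi, Linf zerr & psi (x t) t @[t --> +oo] --> 0])).
Proof.
have [D [D_gt0 DP]] := A5_bound.
have [D1 [D1_gt0 D1P]] := A6.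
have Lg_neq0 y (t : R) : 0 < t -> Dx psi y t (g y) != 0.
  have [delta1 [d0 dP]] := A2 => t0.
  by rewrite -normr_gt0 (lt_trans d0)// dP.
have z_match theta ths : (forall y t, 0 <= t ->
     let us := control_at f g nu psi phi y y ths t in
     Dx psi y t (plant_rhs f g nu theta y us) + Dt psi y t + phi (psi y t) = 0) ->
    forall y (t : R), 0 < t -> zfun nu psi y theta t = zfun nu psi y ths t.
  move=> H y t t0; apply/eqP; rewrite -subr_eq0; apply/eqP.
  by rewrite -(control_cancels (f := f) (phi := phi) Lg_neq0)// (H y t (ltW t0)).
have bounded_state theta u x xi : Om theta -> plant_sol f g nu theta u x ->
    xi_sol fxi x xi -> Linf (fun t => psi (x t) t) -> Linf x /\ Linf xi.
  move=> Omt sx sxi /LinfP[M psiM].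
  have [eps [_ epsP]] := A1 (`|M| + 1) (ltr_wpDl (normr_ge0 M) ltr01).
  have Lx : Linf x.
    apply/LinfP; exists eps => t t0; apply: (epsP _ _ _ Omt sx) => //.
    apply: le_trans (psiM t t0) _; apply: le_trans (ler_norm M) _.
    by rewrite lerDl.
  by split=> //; apply: (A7_sol _ _ _ _ Omt sx sxi).2.
split.
- move=> lam lam0 [K [K0 KP]] theta x xi thI Omt cl xt /LinfP[Z ZP] /LinfP[Q QP].
  have [ths [Oths thsP]] := A3 theta Omt.
  have [sx sxi _] := cl.
  have dirQ (t : R) : 0 < t ->
      `|psi (x t) t *: Dx alpha (xt t) t (dir2' m m2 (usubmx (nu (x t) theta)))
       - Dx Psi (xt t) t (dir2' m m2 (usubmx (nu (x t) theta)))| <= Q.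
    move=> t0; rewrite ((A7_sol _ _ _ _ Omt sx sxi).1 t (ltW t0)) -scalerBl.
    exact: (QP t (ltW t0)).
  have [thL psiL] := leaky_estimate_boundedness nu_C1 psi_C1 alpha_C1 A7_Psi A7_hxi
    Lg_neq0 cl Gam_pos D_gt0 D1_gt0 (z_match _ _ thsP)
    (fun y p t t0 => A5_sign _ Oths y p t (ltW t0))
    (fun y p t t0 => DP _ Oths y p t (ltW t0))
    (D1P _ Oths) A4_sign K0 KP lam0 dirQ ZP.
  by have [xL xiL] := bounded_state _ _ _ _ Omt sx sxi psiL.
move=> Psi9 theta x xi thI xt th dpsi zdiff zerr Omt cl PsiE zd2.
have [ths [Oths thsP]] := A3 theta Omt.
have [sx sxi _] := cl.
have Psi9_C1 : C1 (fun p : 'cV[R]_(m + (m1 + m2)) * R => Psi9 p.1 p.2).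
  case: PsiE => [[-> _]|[-> _]]; last exact: A7_Psi.
  exact: C1_cst.
have dir0 (t : R) : 0 < t ->
    psi (x t) t *: Dx alpha (xt t) t (dir2' m m2 (usubmx (nu (x t) theta)))
    - Dx Psi9 (xt t) t (dir2' m m2 (usubmx (nu (x t) theta))) = 0.
  move=> t0; case: PsiE => [[-> al0]|[-> psiE]].
    by rewrite (al0 t (ltW t0)) scaler0 /Dx diff_cst subr0.
  by rewrite ((A7_sol _ _ _ _ Omt sx sxi).1 t (ltW t0)) (psiE t (ltW t0)) subrr.
pose e (t : R) := zfun nu psi (xt t) (th t) t - zfun nu psi (xt t) ths t.
have [thL psiL phi2 e2 psi0] : [/\ Linf th, Linf (fun t => psi (x t) t),
    L2 (fun t => phi (psi (x t) t)), L2 e & psi (x t) t @[t --> +oo] --> (0 : R)].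
  exact: (L2_estimate_stability nu_C1 psi_C1 alpha_C1 Psi9_C1 A7_hxi
    Lg_neq0 cl Gam_pos D_gt0 D1_gt0 (z_match _ _ thsP)
    (fun y p t t0 => A5_sign _ Oths y p t (ltW t0))
    (fun y p t t0 => DP _ Oths y p t (ltW t0))
    (D1P _ Oths) A4_cont A4_sign A4_pinfty A4_ninfty erefl dir0 zd2).
have [xL xiL] := bounded_state _ _ _ _ Omt sx sxi psiL.
have [cpsi _ _ _ _] := trajectory_continuous nu_C1 psi_C1 alpha_C1 Psi9_C1 A7_hxi cl.
have [czd ce] := mismatch_continuous (ths := ths) nu_C1 psi_C1 alpha_C1 Psi9_C1 A7_hxi cl.
have dpsiE (t : R) : 0 < t -> dpsi t = - phi (psi (x t) t) + zdiff t - e t.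
  move=> t0; rewrite /dpsi derive1E.
  by have [_ ->] := psi_error_is_derive psi_C1 Lg_neq0 cl (z_match _ _ thsP) t0.
have zerrE (t : R) : 0 < t -> zerr t = - e t.
  by move=> t0; rewrite /zerr /e (z_match _ _ thsP _ _ t0) opprB.
have e_bound : exists E, forall t : R, 0 < t -> `|e t| <= E.
  have /LinfP[Mx MxP] := xL; have /LinfP[Mxi MxiP] := xiL; have /LinfP[Mth MthP] := thL.
  have [Mh MhP] := continuous_bounded_on_balls (C1_continuous A7_hxi) Mxi.
  have [Mxt MxtP] := @tilde_norm_bounded R m m1 m2 Mx Mh.
  have [Ma MaP] := alpha_bnd Mxt.
  exists (D * (d%:R * (Ma * (Mth + `|ths|)))) => t t0; have t0' := ltW t0.
  apply: le_trans (DP _ Oths _ _ _ t0') _; rewrite ler_pM2l//.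
  apply: le_trans (dotv_le_norm _ _) _; rewrite ler_wpM2l// ler_pM//.
    by apply: MaP => //; apply: MxtP; [exact: MxP|apply/MhP/MxiP].
  by apply: le_trans (ler_normB _ _) _; rewrite lerD2r MthP.
split.
  split=> //.
  - split=> // -[K [K0 KP]].
    apply: (@L2_dominated _ _ (fun t => psi (x t) t)
      (fun t => K ^- 2 * phi (psi (x t) t) ^+ 2)) => //.
      move=> t _; rewrite mulrC ler_pdivlMr ?exprn_gt0//.
      rewrite mulrC -exprMn -[leLHS]real_normK ?num_real//.
      rewrite -[leRHS]real_normK ?num_real// lerXn2r ?nnegrE//.
      by rewrite normrM gtr0_norm.
    by apply: halfline_integrableZ; apply/L2E.
  - apply: (@L2_dominated _ _ (fun t => - phi (psi (x t) t) + zdiff t - e t)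
      (fun t => 3 * phi (psi (x t) t) ^+ 2
         + 1 * (3 * zdiff t ^+ 2 + 3 * e t ^+ 2))) => //.
    + apply: halfline_continuousB => //; apply: halfline_continuousD => //.
      by move=> t; apply: cvgN; apply: (within_halfline_comp A4_cont cpsi).
    + move=> t t0; rewrite dpsiE//.
      set a := phi _; set b := zdiff t; set c := e t.
      have := sqr_ge0 (a + b); have := sqr_ge0 (a - c); have := sqr_ge0 (b + c).
      rewrite !expr2; lra.
    + apply: halfline_integrable_lincomb; first exact/L2E.
      by apply: halfline_integrable_lincomb; apply/L2E.
  - apply: (@L2_dominated _ _ (fun t => - e t) (fun t => e t ^+ 2)) => //.
    + by move=> t; apply: cvgN; exact: ce.
    + by move=> t t0; rewrite zerrE// sqrrN.
    + exact/L2E.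
move=> _ _ /LinfP[Z ZP]; have [E EP] := e_bound; have /LinfP[B BP] := psiL.
have B0 : - B <= B by have := le_trans (normr_ge0 _) (BP 0 (lexx 0)); lra.
have [c _ cP] : exists2 c, c \in `[- B, B] &
    forall s, s \in `[- B, B] -> `|phi s| <= `|phi c|.
  apply: (@EVT_max _ (fun s => `|phi s|)) => //; apply: continuous_subspaceT => s.
  by apply: cvg_norm; exact: A4_cont.
have phiB (t : R) : 0 <= t -> `|phi (psi (x t) t)| <= `|phi c|.
  by move=> t0; apply: cP; have := BP t t0; rewrite in_itv/= ler_norml.
split=> //.
- apply: (@Linf_pos _ _ _ (`|phi c| + Z + E)) => t t0.
  rewrite dpsiE//; apply: le_trans (ler_normB _ _) _; rewrite lerD ?EP//.
  apply: le_trans (ler_normD _ _) _; by rewrite normrN lerD ?ZP ?phiB// ltW.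
- by apply: (@Linf_pos _ _ _ E) => t t0; rewrite zerrE// normrN EP.
Qed.
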